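(* Let $d=1$. If for every $t\in[0,T]$ and $x\in\mathbb R$ $$\varphi(t,x)=f(t,x+g(t,x))-f(t,x)-\frac{\partial g}{\partial x}(t,x)f(t,x)-\frac{\partial g}{\partial t}(t,x)\neq0,$$ then, conditionally on $\{N_T\ge1\}$, the law of $X_T$ is absolutely continuous with respect to the Lebesgue measure on $\mathbb R$.
   Context: Fix $T>0$. $N$ is a nonlinear Hawkes process on $(\Omega,\mathcal F,\mathbb P)$ (with $\Omega$ the canonical space of càdlàg counting paths started at $0$ with unit jumps), i.e. a counting process with conditional intensity, with respect to its natural filtration, $\lambda^*(t)=\lambda_t+\gamma\big(\int_{(0,t)}\mu(t-s)\,dN_s\big)$. Standing assumptions: $\lambda:\mathbb R_+\to(0,\infty)$ is differentiable with bounded derivative and $\lambda_t\ge\lambda_*>0$ for all $t$; $\mu:\mathbb R_+\to\mathbb R_+$ is $C^1$ with bounded derivative and in $L^1([0,\infty))$; $\gamma:\mathbb R_+\to\mathbb R_+$ is $C^1$ with bounded derivative, $\gamma(0)=0$; and $\sup_{x\ge0}|\gamma'(x)|\int_0^\infty\mu(t)\,dt<1$. $X$ is the unique solution of the SDE $X_t=x_0+\int_0^tf(s,X_s)\,ds+\int_{(0,t]}g(s,X_{s-})\,dN_s$, $0\le t\le T$, with $x_0\in\mathbb R^d$, where $f,g:[0,T]\times\mathbb R^d\to\mathbb R^d$ are measurable and: (1) for each $t$, $f(t,\cdot)$ and $g(t,\cdot)$ are $C^1$; (2) $\sup_{t,x}(|\nabla_xf(t,x)|+|\nabla_xg(t,x)|)<\infty$;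 (3) for each $x$, $g(\cdot,x)$ is differentiable; (4) $\det(I_d+\nabla_xg(t,x))\ne0$ for all $(t,x)\in[0,T]\times\mathbb R^d$ and $(I_d+\nabla_xg)^{-1}$ is uniformly bounded. Here $d=1$. *)

(* Defs.v *)
From HB Require Import structures.
From mathcomp Require Import all_boot all_order all_algebra.
From mathcomp Require Import all_classical all_reals all_analysis.

Set Implicit Arguments.
Unset Strict Implicit.
Unset Printing Implicit Defensive.

Import Order.TTheory GRing.Theory Num.Theory.
Import numFieldNormedType.Exports.

Local Open Scope classical_set_scope.
Local Open Scope ring_scope.

(* Derivatives relative to a set [D]: only increments staying in [D] count, so
   that this is the one-sided derivative at an endpoint of an interval and does
   not depend on the values of [h] outside [D]. *)
Definition diff_quotient {R : realType} (h : R -> R) (t s : R) : R :=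
  (h s - h t) / (s - t).

Definition derivable_in {R : realType} (D : set R) (h : R -> R) (t : R) : Prop :=
  cvg (diff_quotient h t s @[s --> within D t^']).

Definition derive_in {R : realType} (D : set R) (h : R -> R) (t : R) : R :=
  lim (diff_quotient h t s @[s --> within D t^']).

Definition halfline {R : realType} : set R := `[0, +oo[%classic.

Definition bounded_derivative_in {R : realType} (D : set R) (h : R -> R) : Prop :=
  exists C : R, forall t, D t -> `|derive_in D h t| <= C.

Definition C1_in {R : realType} (D : set R) (h : R -> R) : Prop :=
  (forall t, D t -> derivable_in D h t) /\ {within D, continuous (derive_in D h)}.

Definition C1 {R : realType} (h : R -> R) : Prop :=
  (forall x, derivable h x 1) /\ continuous (derive1 h).

Definition left_lim {R : realType} (h : R -> R) (t : R) : R :=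
  lim (h s @[s --> t^'-]).

(* Counting paths on [0, +oo[, extended by 0 to the negative times so that they
   are cumulative functions on the whole line (and have no jump at 0). Left
   limits exist by monotonicity. *)
Record counting_path (R : realType) := CountingPath {
  path_fun :> R -> R ;
  path_nat : forall t, path_fun t \is a Num.nat ;
  path_start : forall t, t <= 0 -> path_fun t = 0 ;
  path_nondecreasing : nondecreasing path_fun ;
  path_right_continuous : right_continuous path_fun ;
  path_unit_jump : forall t, path_fun t - left_lim path_fun t <= 1 }.

HB.instance Definition _ (R : realType) (w : counting_path R) :=
  isCumulative.Build R _ R (path_fun w)
    (@path_nondecreasing R w) (@path_right_continuous R w).

HB.instance Definition _ (R : realType) := gen_eqMixin (counting_path R).
HB.instance Definition _ (R : realType) := gen_choiceMixin (counting_path R).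

Lemma zero_path_unit_jump (R : realType) (t : R) :
  (0 : R) - left_lim (fun=> 0) t <= 1.
Proof. by rewrite /left_lim lim_cst// subr0. Qed.

Definition zero_path (R : realType) : counting_path R.
Proof.
apply: (@CountingPath R (fun=> 0)) => //.
- by move=> t; exact: cvg_cst.
- exact: zero_path_unit_jump.
Defined.

HB.instance Definition _ (R : realType) :=
  isPointed.Build (counting_path R) (zero_path R).

Definition coordinate_events {R : realType} (D : set R) :
    set (set (counting_path R)) :=
  \bigcup_(s in D)
    preimage_set_system setT (fun w : counting_path R => w s) measurable.

Notation canonical_space R :=
  (g_sigma_algebraType (coordinate_events (@halfline R))).

Definition N_ {R : realType} (t : R) (w : canonical_space R) : R := path_fun w t.

Definition dN {R : realType} (w : canonical_space R) :
    {measure set (measurableTypeR R) -> \bar R} :=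
  lebesgue_stieltjes_measure (path_fun w).

Definition natural_filtration {R : realType} (t : R) :
    set (set (canonical_space R)) :=
  <<s coordinate_events `[0, t]%classic >>.

Definition predictable_rectangles {R : realType} :
    set (set (R * canonical_space R)) :=
  [set E | exists s t (A : set (canonical_space R)),
    [/\ 0 <= s, s <= t, natural_filtration s A & E = `]s, t]%classic `*` A]].

(* The trace of this sigma-algebra on positive times is the predictable one;
   only positive times are integrated over below. *)
Definition predictable {R : realType} (C : R * canonical_space R -> R) : Prop :=
  measurable_fun setT
    (C : g_sigma_algebraType (@predictable_rectangles R) -> R).

(* Stochastic intensity of the counting process N for its natural filtration
   (Bremaud, Point Processes and Queues, Definition II.D7). *)
Definition has_intensity {R : realType} (P : probability (canonical_space R) R)
    (lam : R -> canonical_space R -> R) : Prop :=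
  forall C : R * canonical_space R -> R,
    predictable C -> (forall z, 0 <= C z) ->
    (\int[P]_w \int[dN w]_(s in `]0%R, +oo[) (C (s, w))%:E =
     \int[P]_w \int[lebesgue_measure]_(s in `]0%R, +oo[)
       (C (s, w) * lam s w)%:E)%E.

Definition hawkes_intensity {R : realType} (lambda mu gamma : R -> R) (t : R)
    (w : canonical_space R) : R :=
  lambda t + gamma (\int[dN w]_(s in `]0, t[) mu (t - s)).

Definition nonlinear_hawkes {R : realType} (P : probability (canonical_space R) R)
    (lambda mu gamma : R -> R) : Prop :=
  has_intensity P (hawkes_intensity lambda mu gamma).

Record hawkes_assumptions {R : realType} (lambda mu gamma : R -> R) : Prop :=
  HawkesAssumptions {
  lambda_lower_bound : exists2 lambda_star : R, 0 < lambda_star &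
    forall t, halfline t -> lambda_star <= lambda t ;
  lambda_derivable : forall t, halfline t -> derivable_in halfline lambda t ;
  lambda_bounded_derivative : bounded_derivative_in halfline lambda ;
  mu_ge0 : forall t, halfline t -> 0 <= mu t ;
  mu_C1 : C1_in halfline mu ;
  mu_bounded_derivative : bounded_derivative_in halfline mu ;
  mu_integrable : lebesgue_measure.-integrable halfline (EFin \o mu) ;
  gamma_ge0 : forall x, halfline x -> 0 <= gamma x ;
  gamma_C1 : C1_in halfline gamma ;
  gamma_bounded_derivative : bounded_derivative_in halfline gamma ;
  gamma_at0 : gamma 0 = 0 ;
  stability : (ereal_sup [set `|derive_in halfline gamma x|%:E | x in halfline] *
               \int[lebesgue_measure]_(t in halfline) (mu t)%:E < 1)%E }.

Record coefficient_assumptions {R : realType} (T : R) (f g : R -> R -> R) : Prop :=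
  CoefficientAssumptions {
  f_measurable : measurable_fun (`[0, T]%classic `*` [set: R])
    (fun z : R * R => f z.1 z.2) ;
  g_measurable : measurable_fun (`[0, T]%classic `*` [set: R])
    (fun z : R * R => g z.1 z.2) ;
  f_C1 : forall t, t \in `[0, T] -> C1 (f t) ;
  g_C1 : forall t, t \in `[0, T] -> C1 (g t) ;
  fg_bounded_gradient : exists K : R, forall t x, t \in `[0, T] ->
    `|derive1 (f t) x| + `|derive1 (g t) x| <= K ;
  g_derivable_time : forall x t, t \in `[0, T] ->
    derivable_in `[0, T]%classic (g^~ x) t ;
  jump_nondegenerate : forall t x, t \in `[0, T] -> 1 + derive1 (g t) x != 0 ;
  jump_inverse_bounded : exists K : R, forall t x, t \in `[0, T] ->
    `|(1 + derive1 (g t) x)^-1| <= K }.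

Record sde_solution {R : realType} (P : probability (canonical_space R) R)
    (T : R) (f g : R -> R -> R) (x0 : R) (X : R -> canonical_space R -> R) : Prop :=
  SdeSolution {
  sde_adapted : forall t, t \in `[0, T] ->
    forall B : set R, measurable B -> natural_filtration t (X t @^-1` B) ;
  sde_right_continuous : forall w t, t \in `[0, T[ ->
    X s w @[s --> t^'+] --> X t w ;
  sde_left_limits : forall w t, t \in `]0, T] ->
    cvg (X s w @[s --> t^'-]) ;
  sde_equation : {ae P, forall w, forall t, t \in `[0, T] ->
    lebesgue_measure.-integrable `[0, t] (fun s => (f s (X s w))%:E) /\
    X t w = x0 + \int[lebesgue_measure]_(s in `[0, t]) f s (X s w)
               + \int[dN w]_(s in `]0, t]) g s (left_lim (X^~ w) s)} }.

Definition phi {R : realType} (T : R) (f g : R -> R -> R) (t x : R) : R :=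
  f t (x + g t x) - f t x - derive1 (g t) x * f t x
    - derive_in `[0, T]%classic (g^~ x) t.

Definition conditional_law {d} {U : measurableType d} {R : realType}
    (P : probability U R) (A : set U) (Y : U -> R) (B : set R) : \bar R :=
  (fine (P (A `&` Y @^-1` B)) / fine (P A))%:E.

(* Main.v *)
(* Resample the last jump: let Y_t(w) be the terminal state obtained by following
   the path w up to t-, imposing a jump at t, and solving the ODE u' = f(r, u)
   without jumps from t to T. At the last jump time of w, Y_t(w) = X_T(w), so for a
   null set B the predictable process C_t = 1{Y_t in B} satisfies
   P(N_T >= 1, X_T in B) <= E int C dN = E int_0^T C_t lambda*(t) dt,
   and it suffices that {t : Y_t(w) in B} is Lebesgue-null for almost every w.
   Between jumps of w, writing z for the path and y = z + g(t, z), the solution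
   started from y(s) at time s < t satisfies u(t) - y(t) ~ phi(s, z(s)) (t - s),
   and the flow of the ODE is bi-Lipschitz, so t |-> Y_t is locally expansive on
   each of countably many pieces of [0, T]; preimages of null sets under such maps
   are null. *)

Require Import Defs.
From mathcomp Require Import all_boot all_order all_algebra.
From mathcomp Require Import all_classical all_reals all_analysis.
From mathcomp Require Import measurable_realfun.
From mathcomp Require Import ring lra.

Import Order.TTheory GRing.Theory Num.Theory.
Import numFieldNormedType.Exports.

Local Open Scope classical_set_scope.
Local Open Scope ring_scope.

Set Implicit Arguments.
Unset Strict Implicit.
Unset Printing Implicit Defensive.

(** * Integrals over segments and a Gronwall inequality *)

(** The coefficient [f] is only measurable in time, so between jumps the path solves a Caratheodory
    equation, and [phi] can be recovered only at times that are Lebesgue points of the field for all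
    states at once. The radii of validity of these expansions, and of those of [g], depend on the
    time with no uniformity; the pieces are cut so as to fix them. Being defined by such pointwise
    conditions, the pieces may fail to be measurable, and null sets are handled through outer
    measure. The assumptions on the coefficients contain no integrability of [f] in time. It is read
    off one path on which the equation holds, since the drift is integrable there, and the Lipschitz
    bound carries it to every constant state. Predictability dictates the use of left limits of [X],
    and it is also why the flow must be left continuous in its starting time: both are limits of
    quantities read at grid times strictly before [t]. *)

Section interval_integrals.
Context {R : realType}.
Local Notation mu := (@lebesgue_measure R).
Implicit Types (h q : R -> R) (a b c : R).

Lemma integrable_subitv h a b c e : a <= c -> e <= b ->
  mu.-integrable `[a, b] (EFin \o h) -> mu.-integrable `[c, e] (EFin \o h).
Proof.
move=> ac eb; apply: integrableS => //.
by apply: subset_itv; rewrite bnd_simp.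
Qed.

Lemma Rintegral_itv_chasles h a b c : a <= c -> c <= b ->
  mu.-integrable `[a, b] (EFin \o h) ->
  \int[mu]_(v in `[a, b]) h v =
  \int[mu]_(v in `[a, c]) h v + \int[mu]_(v in `[c, b]) h v.
Proof.
move=> ac cb ih; apply/eqP; rewrite addrC -subr_eq; apply/eqP.
rewrite Rintegral_itvB ?bnd_simp// Rintegral_itv_obnd_cbnd//.
apply: integrableS ih => //.
by apply: subset_itv; rewrite bnd_simp.
Qed.

Lemma Rintegral_itv_cst a b c : a <= b ->
  \int[mu]_(_ in `[a, b]) c = c * (b - a).
Proof.
move=> ab; rewrite Rintegral_cst//; congr (_ * _).
have /= := lebesgue_measure_itv (`[a, b] : interval R).
rewrite lte_fin => ->; case: ltP => // ba.
by rewrite (le_anti (introT andP (conj ab ba))) subrr.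
Qed.

Lemma integrable_itv_cst a b c : mu.-integrable `[a, b] (EFin \o cst c).
Proof.
apply: continuous_compact_integrable; first exact: segment_compact.
by apply: continuous_subspaceT => x; exact: cst_continuous.
Qed.

Lemma integrable_itvB h q a b : mu.-integrable `[a, b] (EFin \o h) ->
  mu.-integrable `[a, b] (EFin \o q) ->
  mu.-integrable `[a, b] (EFin \o (fun v => h v - q v)).
Proof. by move=> ih iq; have := integrableB _ ih iq; apply => //. Qed.

Lemma integrable_itvD h q a b : mu.-integrable `[a, b] (EFin \o h) ->
  mu.-integrable `[a, b] (EFin \o q) ->
  mu.-integrable `[a, b] (EFin \o (fun v => h v + q v)).
Proof. by move=> ih iq; have := integrableD _ ih iq; apply => //. Qed.

Lemma integrable_itvZl k h a b : mu.-integrable `[a, b] (EFin \o h) ->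
  mu.-integrable `[a, b] (EFin \o (fun v => k * h v)).
Proof. by move=> ih; have := integrableZl _ k ih; apply => //. Qed.

Lemma integrable_itv_norm h a b : mu.-integrable `[a, b] (EFin \o h) ->
  mu.-integrable `[a, b] (EFin \o (fun v => `|h v|)).
Proof. by move=> ih; exact: (integrable_norm ih). Qed.

Lemma le_Rintegral_itv a b h q :
  mu.-integrable `[a, b] (EFin \o h) -> mu.-integrable `[a, b] (EFin \o q) ->
  (forall v, a <= v <= b -> h v <= q v) ->
  \int[mu]_(v in `[a, b]) h v <= \int[mu]_(v in `[a, b]) q v.
Proof.
move=> ih iq hq; apply: le_Rintegral => // x /=; rewrite in_itv/=; exact: hq.
Qed.

Lemma Rintegral_sub_itv h a b c e : a <= c -> e <= b ->
  mu.-integrable `[a, b] (EFin \o h) -> (forall v, 0 <= h v) ->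
  \int[mu]_(v in `[c, e]) h v <= \int[mu]_(v in `[a, b]) h v.
Proof.
move=> ac eb ih h0.
have [ce|ec] := leP c e; last first.
  by rewrite set_itv_ge ?bnd_simp -?ltNge// Rintegral_set0 Rintegral_ge0.
rewrite (@Rintegral_itv_chasles h a b c)// ?(le_trans ce)//.
rewrite (@Rintegral_itv_chasles h c b e)//; last exact: integrable_subitv ih.
have := @Rintegral_ge0 _ _ _ mu `[a, c] h (fun v _ => h0 v).
have := @Rintegral_ge0 _ _ _ mu `[e, b] h (fun v _ => h0 v).
lra.
Qed.

Lemma integrable_continuous_itv h a b : continuous h ->
  mu.-integrable `[a, b] (EFin \o h).
Proof.
move=> ch; apply: continuous_compact_integrable; first exact: segment_compact.
exact: continuous_subspaceT.
Qed.

Lemma continuous_expR_affine c e : continuous (fun v : R => expR (c * (v - e))).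
Proof.
move=> x; apply: (@continuous_comp _ _ _ (fun v : R => c * (v - e)) expR).
  by apply: cvgMr; apply: cvgB; [exact: cvg_id|exact: cvg_cst].
exact: continuous_expR.
Qed.

Lemma Rintegral_expR_affine c e a b : a <= b ->
  \int[mu]_(v in `[a, b]) (c * expR (c * (v - e))) =
  expR (c * (b - e)) - expR (c * (a - e)).
Proof.
rewrite le_eqVlt => /predU1P[->|ab].
  by rewrite set_itv1 Rintegral_set1 subrr.
have dF (x : R) : is_derive x 1 (fun v : R => expR (c * (v - e)))
    (c * expR (c * (x - e))).
  apply: is_derive_eq; rewrite /GRing.scale/=; ring.
have cF := @continuous_expR_affine c e.
rewrite /Rintegral (@continuous_FTC2 _ _ (fun v => expR (c * (v - e))))//.
- apply: continuous_subspaceT => x; apply: cvgMr; exact: cF.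
- split.
  + by move=> x _; have [] := dF x.
  + by apply: cvg_at_right_filter; exact: cF.
  + by apply: cvg_at_left_filter; exact: cF.
- by move=> x _; rewrite derive1E; apply: derive_val.
Qed.

(* Comparing [d] with the weight [W], in place of differentiating, lets [d] be
   non-measurable. *)
Lemma gronwall_weight (K A M a b : R) (d q W : R -> R) (lo hi : R -> R) :
  (forall r, a <= r <= b -> [/\ a <= lo r, hi r <= b & lo r <= hi r]) ->
  mu.-integrable `[a, b] (EFin \o q) -> continuous W ->
  (forall r, 0 <= d r) -> (forall r, a <= r <= b -> d r <= M) ->
  (forall r, a <= r <= b -> q r <= K * d r) -> 0 <= K -> 0 <= A ->
  (forall r, a <= r <= b -> 1 <= W r) ->
  (forall r, a <= r <= b -> d r <= A + \int[mu]_(v in `[lo r, hi r]) q v) ->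
  (forall r, a <= r <= b ->
    \int[mu]_(v in `[lo r, hi r]) (2 * K * W v) <= W r) ->
  forall r, a <= r <= b -> d r <= 2 * A * W r.
Proof.
move=> lh iq cW d0 dM qd K0 A0 W1 dA Wint r0 r0ab.
pose E := [set d r / W r | r in [set r | a <= r <= b]].
have W0 r : a <= r <= b -> 0 < W r by move=> /W1; exact: lt_le_trans.
have ubE : has_ubound E.
  exists M => _ [r rab <-]; rewrite ler_pdivrMr ?W0//.
  rewrite (le_trans (dM _ rab))// ler_peMr ?W1//.
  exact: le_trans (dM _ rab).
have dS r : a <= r <= b -> d r <= sup E * W r.
  move=> rab; rewrite -ler_pdivrMr ?W0//.
  by apply: ub_le_sup => //; exists r.
have S0 : 0 <= sup E.
  apply: (le_trans _ (ub_le_sup ubE _)); last by exists r0; [exact: r0ab|].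
  by rewrite divr_ge0// ltW// W0.
(* The integral of [2 * K * W] over the window is at most [W], so the Lipschitz rate [K] costs only
   half of the supremum, which is absorbed. This is the origin of the factor 2 in the Gronwall
   bounds below. *)
have SA : sup E <= A + sup E / 2.
  apply: ge_sup; first by exists (d r0 / W r0), r0.
  move=> _ [r rab <-]; rewrite ler_pdivrMr ?W0//.
  have [alo hib lohi] := lh _ rab.
  apply: (le_trans (dA _ rab)).
  have iW : mu.-integrable `[lo r, hi r] (EFin \o (fun v => 2 * K * W v)).
    by apply: integrable_itvZl; exact: integrable_continuous_itv.
  have : \int[mu]_(v in `[lo r, hi r]) q v <=
         \int[mu]_(v in `[lo r, hi r]) (sup E / 2 * (2 * K * W v)).
    apply: le_Rintegral_itv.
    - exact: integrable_subitv iq.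
    - exact: integrable_itvZl.
    - move=> v /andP[lov vhi].
      have vab : a <= v <= b by rewrite (le_trans alo)//= (le_trans vhi).
      apply: (le_trans (qd _ vab)).
      have -> : sup E / 2 * (2 * K * W v) = K * (sup E * W v) by field.
      exact: ler_wpM2l (dS _ vab).
  rewrite RintegralZl//.
  have := ler_wpM2l (_ : 0 <= sup E / 2) (Wint _ rab).
  move=> /(_ ltac:(lra)) h1 h2.
  have := W1 _ rab; nra.
have := dS _ r0ab; have := W0 _ r0ab; nra.
Qed.

End interval_integrals.

(** * Caratheodory differential equations and their flow *)

Section ode.
Context {R : realType}.
Local Notation mu := (@lebesgue_measure R).
Variables (F : R -> R -> R) (K : R).
Hypothesis K0 : 0 < K.
Hypothesis mF : measurable_fun setT (fun z : R * R => F z.1 z.2).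
Hypothesis lipF : forall t x y, `|F t x - F t y| <= K * `|x - y|.
Hypothesis intF : forall x, mu.-integrable setT (EFin \o F^~ x).
Implicit Types (u v : R -> R) (a b x y : R).

Definition ode_solution u a b :=
  mu.-integrable `[a, b] (EFin \o (fun s => F s (u s))) /\
  forall r, a <= r <= b -> u r = u a + \int[mu]_(s in `[a, r]) F s (u s).

Lemma integrable_field x a b : mu.-integrable `[a, b] (EFin \o F^~ x).
Proof. exact: integrableS (intF x). Qed.

Lemma ode_solution_subitv u a b c e : a <= c -> e <= b ->
  ode_solution u a b -> ode_solution u c e.
Proof.
move=> ac eb [iu uE]; split; first exact: integrable_subitv iu.
move=> r /andP[cr re].
have rb := le_trans re eb.
rewrite (uE r) ?(le_trans ac cr)// (uE c) ?ac ?(le_trans cr)//.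
rewrite (@Rintegral_itv_chasles _ _ a r c)// ?addrA//.
exact: integrable_subitv iu.
Qed.

Lemma ode_solution_bounded u a b : ode_solution u a b ->
  forall r, a <= r <= b ->
  `|u r - u a| <= \int[mu]_(s in `[a, b]) `|F s (u s)|.
Proof.
move=> [iu uE] r /andP[ar rb].
rewrite uE ?ar// addrAC subrr add0r.
apply: le_trans (le_normr_Rintegral _ _) _ => //.
  exact: integrable_subitv iu.
apply: Rintegral_sub_itv => //; exact: integrable_itv_norm.
Qed.

Lemma integrable_ode_diff u v a b : ode_solution u a b -> ode_solution v a b ->
  mu.-integrable `[a, b] (EFin \o (fun s => `|F s (u s) - F s (v s)|)).
Proof.
by move=> [iu _] [iv _]; apply: integrable_itv_norm; exact: integrable_itvB.
Qed.

Lemma ode_diffE u v a b : ode_solution u a b -> ode_solution v a b ->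
  forall c r, a <= c -> c <= r -> r <= b ->
  u r - v r - (u c - v c) = \int[mu]_(s in `[c, r]) (F s (u s) - F s (v s)).
Proof.
move=> su sv c r ac cr rb.
have [iu uE] := ode_solution_subitv ac rb su.
have [iv vE] := ode_solution_subitv ac rb sv.
rewrite (uE r) ?cr ?lexx// (vE r) ?cr ?lexx// RintegralB//; ring.
Qed.

Lemma ode_diff_le u v a b : ode_solution u a b -> ode_solution v a b ->
  forall c r, a <= c -> c <= r -> r <= b ->
  `|(u r - v r) - (u c - v c)| <=
  \int[mu]_(s in `[c, r]) `|F s (u s) - F s (v s)|.
Proof.
move=> su sv c r ac cr rb; rewrite (ode_diffE su sv)//.
apply: le_normr_Rintegral => //; apply: integrable_itvB.
- by apply: integrable_subitv su.1.
- by apply: integrable_subitv sv.1.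
Qed.

(** Crude but finite: it supplies the a priori bound [M] of [gronwall_weight], which makes the
    supremum taken there meaningful. *)
Lemma ode_diff_bounded u v a b : ode_solution u a b -> ode_solution v a b ->
  forall r, a <= r <= b -> `|u r - v r| <=
  `|u a - v a| + \int[mu]_(s in `[a, b]) `|F s (u s) - F s (v s)|.
Proof.
move=> su sv r /andP[ar rb].
have := ode_diff_le su sv (lexx a) ar rb.
have := Rintegral_sub_itv (lexx a) rb (integrable_ode_diff su sv)
  (fun=> normr_ge0 _).
have := ler_normD (u r - v r - (u a - v a)) (u a - v a).
rewrite subrK; lra.
Qed.

Let weight_fwd a r : a <= r ->
  \int[mu]_(s in `[a, r]) (2 * K * expR (2 * K * (s - a))) <=
  expR (2 * K * (r - a)).
Proof.
move=> ar; rewrite Rintegral_expR_affine//.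
by rewrite lerBlDr lerDl expR_ge0.
Qed.

Let weight_bwd b r : r <= b ->
  \int[mu]_(s in `[r, b]) (2 * K * expR (- (2 * K) * (s - b))) <=
  expR (- (2 * K) * (r - b)).
Proof.
move=> rb.
rewrite (@eq_Rintegral _ _ _ mu _ (fun s => (-1) * (- (2 * K) * expR (- (2 * K) * (s - b))))); last first.
  by move=> s _; ring.
rewrite RintegralZl//.
  rewrite Rintegral_expR_affine//.
  have := expR_ge0 (- (2 * K) * (b - b)); lra.
apply: integrable_itvZl; apply: integrable_continuous_itv.
exact: continuous_expR_affine.
Qed.

Lemma gronwall_forward u v a b : ode_solution u a b -> ode_solution v a b ->
  forall r, a <= r <= b ->
  `|u r - v r| <= 2 * `|u a - v a| * expR (2 * K * (r - a)).
Proof.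
move=> su sv.
apply: (@gronwall_weight _ K _ (`|u a - v a| + \int[mu]_(s in `[a, b])
    `|F s (u s) - F s (v s)|) a b (fun r => `|u r - v r|)
    (fun s => `|F s (u s) - F s (v s)|) _ (fun=> a) id) => //.
- by move=> r /andP[->].
- exact: integrable_ode_diff.
- exact: continuous_expR_affine.
- exact: ode_diff_bounded.
- exact: ltW.
- move=> r /andP[ar rb]; rewrite -expR0 ler_expR mulr_ge0 ?mulr_ge0 ?subr_ge0//.
  exact: ltW.
- move=> r /andP[ar rb].
  have := ode_diff_le su sv (lexx a) ar rb.
  have := ler_normD (u r - v r - (u a - v a)) (u a - v a).
  rewrite subrK; lra.
- by move=> r /andP[ar rb]; exact: weight_fwd.
Qed.

(** Time is not reversed: the windows become [[r, b]] and the weight grows towards the left. This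
    version bounds the distance of two terminal values from below. *)
Lemma gronwall_backward u v a b : ode_solution u a b -> ode_solution v a b ->
  forall r, a <= r <= b ->
  `|u r - v r| <= 2 * `|u b - v b| * expR (2 * K * (b - r)).
Proof.
move=> su sv r rab.
have -> : 2 * K * (b - r) = - (2 * K) * (r - b) by ring.
move: r rab; apply: (@gronwall_weight _ K _ (`|u a - v a| + \int[mu]_(s in `[a, b])
    `|F s (u s) - F s (v s)|) a b (fun r => `|u r - v r|)
    (fun s => `|F s (u s) - F s (v s)|)
    (fun r => expR (- (2 * K) * (r - b))) id (fun=> b)) => //.
- by move=> r /andP[].
- exact: integrable_ode_diff.
- exact: continuous_expR_affine.
- exact: ode_diff_bounded.
- exact: ltW.
- move=> r /andP[ar rb]; rewrite -expR0 ler_expR mulNr -mulrN opprB.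
  by rewrite mulr_ge0 ?mulr_ge0 ?subr_ge0// ltW.
- move=> r /andP[ar rb].
  have := ode_diff_le su sv ar rb (lexx b).
  have := ler_normD (u b - v b) (- (u b - v b - (u r - v r))).
  rewrite normrN opprB addrCA subrr addr0; lra.
- by move=> r /andP[ar rb]; exact: weight_bwd.
Qed.

(** The solution is compared with the constant [u a]. The defect of that constant is the integral of
    [|F s (u a)|], which depends on the solution through its initial value only. *)
Lemma ode_initial_growth u a b : ode_solution u a b ->
  forall r, a <= r <= b ->
  `|u r - u a| <= 2 * \int[mu]_(s in `[a, b]) `|F s (u a)| * expR (2 * K * (r - a)).
Proof.
move=> su; have ix := integrable_field (u a) a b.
have iq : mu.-integrable `[a, b] (EFin \o (fun s => `|F s (u s) - F s (u a)|)).
  by apply: integrable_itv_norm; apply: integrable_itvB => //; exact: su.1.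
apply: (@gronwall_weight _ K _ (\int[mu]_(s in `[a, b]) `|F s (u s)|) a b
    (fun r => `|u r - u a|) (fun s => `|F s (u s) - F s (u a)|) _ (fun=> a) id)
    => //.
- by move=> r /andP[->].
- exact: continuous_expR_affine.
- exact: ode_solution_bounded.
- exact: ltW.
- exact: Rintegral_ge0.
- move=> r /andP[ar rb]; rewrite -expR0 ler_expR mulr_ge0 ?mulr_ge0 ?subr_ge0//.
  exact: ltW.
- move=> r /andP[ar rb]; rewrite (su.2 r) ?ar// addrAC subrr add0r.
  have su' := integrable_subitv (lexx a) rb su.1.
  have ix' := integrable_subitv (lexx a) rb ix.
  have iq' := integrable_subitv (lexx a) rb iq.
  apply: (le_trans (le_normr_Rintegral _ su')) => //.
  apply: le_trans (_ : _ <= \int[mu]_(s in `[a, r])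
      (`|F s (u a)| + `|F s (u s) - F s (u a)|)) _.
    apply: le_Rintegral_itv.
    - exact: integrable_itv_norm.
    - by apply: integrable_itvD => //; exact: integrable_itv_norm.
    - move=> s _; apply: le_trans (ler_normD _ _).
      by rewrite addrCA subrr addr0.
  rewrite RintegralD//; last exact: integrable_itv_norm.
  rewrite lerD2r; apply: Rintegral_sub_itv => //; exact: integrable_itv_norm.
- by move=> r /andP[ar rb]; exact: weight_fwd.
Qed.

End ode.

(** * Picard iteration and the flow to the terminal time *)

Section flow.
Context {R : realType}.
Local Notation mu := (@lebesgue_measure R).
Variables (F : R -> R -> R) (K : R).
Hypothesis K0 : 0 < K.
Hypothesis mF : measurable_fun setT (fun z : R * R => F z.1 z.2).
Hypothesis lipF : forall t x y, `|F t x - F t y| <= K * `|x - y|.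
Hypothesis intF : forall x, mu.-integrable setT (EFin \o F^~ x).
Implicit Types (u v : R -> R) (a b x y : R).

Lemma integrable_field_comp u a b x M : measurable_fun `[a, b] u ->
  (forall r, a <= r <= b -> `|u r - x| <= M) ->
  mu.-integrable `[a, b] (EFin \o (fun s => F s (u s))).
Proof.
move=> mu_ uM.
have iM : mu.-integrable `[a, b] (EFin \o (fun s => `|F s x| + K * M)).
  apply: integrable_itvD; last exact: integrable_itv_cst.
  exact: integrable_itv_norm (integrable_field intF _ _ _).
apply: le_integrable iM => //.
  apply/measurable_EFinP.
  have mr : measurable_fun setT (u \_ `[a, b]).
    by apply/(measurable_restrictT _ _).1.
  have mp := measurable_funTS (measurableT_comp mF
    (measurable_fun_pair (@measurable_id _ _ _) mr)) (D := `[a, b]).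
  apply: eq_measurable_fun mp => s sab.
  by rewrite /= patchE sab.
move=> s; rewrite /= in_itv/= => sab.
rewrite lee_fin.
have h1 := ler_wpM2l (ltW K0) (uM _ sab); have h2 := lipF s (u s) x.
have := ler_normD (F s (u s) - F s x) (F s x); rewrite subrK.
have := ler_norm (`|F s x| + K * M); lra.
Qed.

Fixpoint picard a x n : R -> R :=
  if n is m.+1 then fun r => x + \int[mu]_(s in `[a, r]) F s (picard a x m s)
  else cst x.

Lemma picard_regular a b x n : a <= b ->
  measurable_fun `[a, b] (picard a x n) /\
  exists M, forall r, a <= r <= b -> `|picard a x n r - x| <= M.
Proof.
move=> ab; elim: n => [|n [mn [M nM]]] /=.
  split; first exact: measurable_cst.
  by exists 0 => r _; rewrite subrr normr0.
have ip := integrable_field_comp mn nM.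
split.
  apply: measurable_funD; first exact: measurable_cst.
  apply: subspace_continuous_measurable_fun => //.
  exact: (parameterized_integral_continuous ab ip).
exists (\int[mu]_(s in `[a, b]) `|F s (picard a x n s)|) => r /andP[ar rb].
rewrite addrAC subrr add0r.
apply: le_trans (le_normr_Rintegral _ _) _ => //.
  exact: integrable_subitv ip.
apply: Rintegral_sub_itv => //; exact: integrable_itv_norm.
Qed.

Lemma picard_integrable a b x n : a <= b ->
  mu.-integrable `[a, b] (EFin \o (fun s => F s (picard a x n s))).
Proof.
by move=> ab; have [mn [M nM]] := picard_regular x n ab;
  exact: integrable_field_comp mn nM.
Qed.

Lemma le_Rintegral_lip u v a b c r D : a <= c -> c <= r -> r <= b ->
  mu.-integrable `[a, b] (EFin \o (fun s => F s (u s))) ->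
  mu.-integrable `[a, b] (EFin \o (fun s => F s (v s))) ->
  continuous D ->
  (forall s, a <= s <= b -> `|u s - v s| <= D s) ->
  `|\int[mu]_(s in `[c, r]) F s (u s) - \int[mu]_(s in `[c, r]) F s (v s)| <=
  \int[mu]_(s in `[c, r]) (K * D s).
Proof.
move=> ac cr rb iu iv cD uvD.
have iu' := integrable_subitv ac rb iu; have iv' := integrable_subitv ac rb iv.
have iuv := integrable_itvB iu' iv'.
rewrite -RintegralB//; apply: (le_trans (le_normr_Rintegral _ iuv)) => //.
apply: le_Rintegral_itv.
- exact: integrable_itv_norm.
- by apply: integrable_itvZl; exact: integrable_continuous_itv.
- move=> s /andP[cs sr]; apply: (le_trans (lipF _ _ _)).
  by rewrite ler_wpM2l ?(ltW K0)// uvD// (le_trans ac)//= (le_trans sr).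
Qed.

(** In the supremum norm weighted by [expR (2 * K * (r - a))] the Picard map contracts by 1/2, so
    one geometric rate holds on segments of any length. *)
Lemma picard_step a b x n : a <= b -> forall r, a <= r <= b ->
  `|picard a x n.+1 r - picard a x n r| <=
  (\int[mu]_(s in `[a, b]) `|F s x|) * 2^-1 ^+ n * expR (2 * K * (r - a)).
Proof.
move=> ab; elim: n => [|n IHn] r /andP[ar rb].
  rewrite /= addrAC subrr add0r expr0 mulr1.
  have ix := integrable_field intF x a b.
  have ixr := integrable_subitv (lexx a) rb ix.
  apply: (le_trans (le_normr_Rintegral _ ixr)) => //.
  apply: (@le_trans _ _ (\int[mu]_(s in `[a, b]) `|F s x|)).
    by apply: Rintegral_sub_itv => //; exact: integrable_itv_norm.
  rewrite ler_peMr//; first exact: Rintegral_ge0.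
  rewrite -expR0 ler_expR mulr_ge0 ?mulr_ge0 ?subr_ge0//; exact: ltW.
set M := (X in X * _ * _) in IHn *.
pose D s := M * 2^-1 ^+ n * expR (2 * K * (s - a)).
have cD : continuous D by move=> s; apply: cvgMr; exact: continuous_expR_affine.
have -> : picard a x n.+2 r - picard a x n.+1 r =
  \int[mu]_(s in `[a, r]) F s (picard a x n.+1 s) -
  \int[mu]_(s in `[a, r]) F s (picard a x n s) by rewrite /=; ring.
apply: (le_trans (le_Rintegral_lip (lexx a) ar rb (picard_integrable _ _ ab)
  (picard_integrable _ _ ab) cD IHn)).
have -> : \int[mu]_(s in `[a, r]) (K * D s) =
    M * 2^-1 ^+ n.+1 * \int[mu]_(s in `[a, r]) (2 * K * expR (2 * K * (s - a))).
  rewrite -RintegralZl//; last first.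
    apply: integrable_itvZl; apply: integrable_continuous_itv.
    exact: continuous_expR_affine.
  by apply: eq_Rintegral => s _; rewrite /D exprS; field.
rewrite ler_wpM2l//.
  by rewrite mulr_ge0 ?exprn_ge0 ?invr_ge0// Rintegral_ge0.
by rewrite Rintegral_expR_affine// lerBlDr lerDl expR_ge0.
Qed.

Lemma le0_geometric_half (C y : R) : (forall n, y <= C * 2^-1 ^+ n) -> y <= 0.
Proof.
move=> yC; have Cn : geometric C (2^-1 : R) @ \oo --> (0 : R).
  by apply: cvg_geometric; rewrite ger0_norm ?invr_ge0// invf_lt1// ltr1n.
by apply: ler_cvg_to (@cvg_cst _ _ _ _ _) Cn _; apply: nearW => n; exact: yC.
Qed.

Lemma ode_exists a b x : a <= b -> exists u, ode_solution F u a b /\ u a = x.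
Proof.
move=> ab.
pose C := 2 * ((\int[mu]_(s in `[a, b]) `|F s x|) * expR (2 * K * (b - a))).
have C0 : 0 <= C by rewrite !mulr_ge0 ?expR_ge0// Rintegral_ge0.
pose p n r := picard a x n r.
have step n r : a <= r <= b -> `|p n.+1 r - p n r| <= C / 2 * 2^-1 ^+ n.
  move=> rab; apply: (le_trans (picard_step x n ab rab)).
  have -> : C / 2 * 2^-1 ^+ n = (\int[mu]_(s in `[a, b]) `|F s x|) *
      2^-1 ^+ n * expR (2 * K * (b - a)) by rewrite /C; field.
  rewrite ler_wpM2l ?mulr_ge0 ?exprn_ge0 ?invr_ge0 ?Rintegral_ge0//.
  move/andP: rab => [ar rb]; rewrite ler_expR ler_wpM2l ?lerB//.
  by rewrite mulr_ge0// ltW.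
have lo_nd r : a <= r <= b -> forall n m, (n <= m)%N ->
    p n r - C * 2^-1 ^+ n <= p m r - C * 2^-1 ^+ m.
  move=> rab n m nm; rewrite -(subnKC nm); elim: (m - n)%N => [|k IHk].
    by rewrite addn0.
  rewrite addnS; apply: (le_trans IHk).
  have := step (n + k)%N _ rab; rewrite exprS ler_norml; lra.
have hi_ni r : a <= r <= b -> forall n m, (n <= m)%N ->
    p m r + C * 2^-1 ^+ m <= p n r + C * 2^-1 ^+ n.
  move=> rab n m nm; rewrite -(subnKC nm); elim: (m - n)%N => [|k IHk].
    by rewrite addn0.
  rewrite addnS; apply: le_trans IHk.
  have := step (n + k)%N _ rab; rewrite exprS ler_norml; lra.
have H0 n : 0 <= C * 2^-1 ^+ n by rewrite mulr_ge0// exprn_ge0// invr_ge0.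
have lohi r : a <= r <= b -> forall n m,
    p n r - C * 2^-1 ^+ n <= p m r + C * 2^-1 ^+ m.
  move=> rab n m.
  have := lo_nd _ rab _ _ (leq_maxl n m); have := hi_ni _ rab _ _ (leq_maxr n m).
  have := H0 (maxn n m); lra.
(* The bound on a step is exactly the gap between the radii [C * 2^-1 ^+ n] and [C * 2^-1 ^+ n.+1],
   so the intervals of these radii around [p n r] are nested. Their common point gives the limit
   together with its rate. *)
pose u r := sup (range (fun n => p n r - C * 2^-1 ^+ n)).
have up r n : a <= r <= b -> `|p n r - u r| <= C * 2^-1 ^+ n.
  move=> rab.
  have : p n r - C * 2^-1 ^+ n <= u r.
    apply: ub_le_sup; last by exists n.
    by exists (p 0 r + C * 2^-1 ^+ 0) => _ [m _ <-]; exact: lohi.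
  have : u r <= p n r + C * 2^-1 ^+ n.
    apply: ge_sup; first by exists (p 0 r - C * 2^-1 ^+ 0), 0%N.
    by move=> _ [m _ <-]; exact: lohi.
  rewrite ler_norml; lra.
have ux r : a <= r <= b -> `|u r - x| <= C.
  by move=> /(up r 0); rewrite expr0 mulr1 distrC.
have pu r : a <= r <= b -> p n r @[n --> \oo] --> u r.
  move=> rab; have Cn : geometric C (2^-1 : R) @ \oo --> (0 : R).
    by apply: cvg_geometric; rewrite ger0_norm ?invr_ge0// invf_lt1// ltr1n.
  apply/cvgrPdist_le => e e0.
  move/cvgrPdist_le : Cn => /(_ _ e0); apply: filterS => n.
  rewrite sub0r normrN; apply: le_trans; rewrite distrC.
  exact: le_trans (up _ _ rab) (ler_norm _).
have mu_ : measurable_fun `[a, b] u.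
  apply: (@measurable_fun_cvg _ _ _ _ p) => //.
    by move=> n; have [] := picard_regular x n ab.
have iu := integrable_field_comp mu_ ux.
have uE r : a <= r <= b -> u r = x + \int[mu]_(s in `[a, r]) F s (u s).
  move=> /[dup] rab /andP[ar rb]; apply/eqP; rewrite -subr_eq0 -normr_le0.
  apply: (@le0_geometric_half (C + K * C * (r - a))) => n.
  have := up _ n.+1 rab.
  have := le_Rintegral_lip (lexx a) ar rb (picard_integrable x n ab) iu
    (@cst_continuous _ _ (C * 2^-1 ^+ n)) (fun s sab => up s n sab).
  rewrite Rintegral_itv_cst// => h1 h2.
  have := ler_normD (- (p n.+1 r - u r))
    (\int[mu]_(s in `[a, r]) F s (picard a x n s) -
     \int[mu]_(s in `[a, r]) F s (u s)).
  have -> : - (p n.+1 r - u r) + (\int[mu]_(s in `[a, r]) F s (picard a x n s) -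
      \int[mu]_(s in `[a, r]) F s (u s)) =
      u r - (x + \int[mu]_(s in `[a, r]) F s (u s)) by rewrite /p /=; ring.
  rewrite normrN; have := H0 n; move: h2; rewrite exprS; lra.
have ua : u a = x by rewrite uE ?lexx// set_itv1 Rintegral_set1 addr0.
by exists u; split => //; split => // r rab; rewrite ua uE.
Qed.

Variable T : R.

(** For [a <= T] exactly one value qualifies, by Picard and Gronwall. For [a > T] the integral
    equation is vacuous and the value is arbitrary, hence the truncations at [T] further down. *)
Definition flow a x :=
  xget 0 [set y | exists u, [/\ ode_solution F u a T, u a = x & u T = y]].

Lemma flowE u a : a <= T -> ode_solution F u a T -> flow a (u a) = u T.
Proof.
move=> aT su; rewrite /flow; case: xgetP; last first.
  by move=> /(_ (u T)) /=; case; exists u.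
move=> _ -> [v [sv va <-]]; apply/eqP; rewrite -subr_eq0 -normr_le0.
have := gronwall_forward K0 lipF sv su (r := T); rewrite aT lexx => /(_ isT).
by rewrite va subrr normr0 mulr0 mul0r.
Qed.

Lemma flowP a x : a <= T ->
  exists u, [/\ ode_solution F u a T, u a = x & flow a x = u T].
Proof.
move=> aT; have [u [su ua]] := ode_exists x aT; exists u; split => //.
by rewrite -ua (flowE aT su).
Qed.

Lemma flow_semigroup a b x : a <= b -> b <= T ->
  exists u, [/\ ode_solution F u a b, u a = x & flow a x = flow b (u b)].
Proof.
move=> ab bT; have [u [su ua ->]] := flowP x (le_trans ab bT).
exists u; split => //; first exact: ode_solution_subitv su.
by rewrite flowE//; exact: ode_solution_subitv su.
Qed.

Lemma flow_lipschitz a x y : a <= T ->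
  `|flow a x - flow a y| <= 2 * expR (2 * K * (T - a)) * `|x - y|.
Proof.
move=> aT; have [u [su <- ->]] := flowP x aT; have [v [sv <- ->]] := flowP y aT.
have := gronwall_forward K0 lipF su sv (r := T); rewrite aT lexx => /(_ isT).
by rewrite mulrAC.
Qed.

Lemma flow_expansive a x y : a <= T ->
  `|x - y| <= 2 * expR (2 * K * (T - a)) * `|flow a x - flow a y|.
Proof.
move=> aT; have [u [su <- ->]] := flowP x aT; have [v [sv <- ->]] := flowP y aT.
have := gronwall_backward K0 lipF su sv (r := a); rewrite aT lexx => /(_ isT).
by rewrite mulrAC.
Qed.

Lemma continuous_flow a : a <= T -> continuous (flow a).
Proof.
move=> aT x; apply/cvgrPdist_le => e e0.
pose L := 2 * expR (2 * K * (T - a)).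
have L0 : 0 < L by rewrite mulr_gt0// expR_gt0.
near=> y; apply: (le_trans (flow_lipschitz _ _ aT)).
rewrite -/L mulrC -ler_pdivlMr//.
near: y; apply: cvgr_dist_le; first exact: cvg_id.
by rewrite divr_gt0.
Unshelve. all: by end_near. Qed.

(** By the semigroup property both values are images under [flow b], of [u b] and of [x]; these two
    differ by at most a multiple of the integral of [|F r x|] over [[s n, b]], which tends to 0.
    Staying within distance 1 of [b] bounds the growth factor, hence the [expR (2 * K * 1)] in
    [L]. *)
Lemma flow_left_cvg b x (s : nat -> R) : b <= T -> (forall n, s n <= b) ->
  s @ \oo --> b -> flow (s n) x @[n --> \oo] --> flow b x.
Proof.
move=> bT sb cs.
have iF := integrable_itv_norm (integrable_field intF x (b - 1) b).
have := parameterized_integral_cvg_at_left (_ : b - 1 < b) iF.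
rewrite ltrBlDr ltrDl => /(_ ltr01) cI.
pose L := 2 * expR (2 * K * (T - b)) * (2 * expR (2 * K * 1)).
have L0 : 0 < L by rewrite !mulr_gt0// expR_gt0.
apply/cvgrPdist_le => e e0.
have : \forall t \near b, b - 1 < t -> t <= b ->
    `|\int[mu]_(r in `[t, b]) `|F r x| | <= e / L.
  move/cvgrPdist_le : cI => /(_ (e / L)); rewrite divr_gt0// => /(_ isT).
  rewrite near_withinE; apply: filterS => t tP b1t.
  rewrite le_eqVlt => /predU1P[->|tb].
    by rewrite set_itv1 Rintegral_set1 normr0 divr_ge0 ?ltW.
  move: (tP tb).
  by rewrite /parameterized_integral (Rintegral_itv_chasles (ltW b1t) (ltW tb) iF)
    addrAC subrr add0r.
move=> /cs nearI.
have near1 : \forall n \near \oo, b - 1 < s n.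
  by apply: (cvgr_gt _ cs); rewrite ltrBlDr ltrDl.
near=> n.
have b1s : b - 1 < s n by near: n.
have [u [su us ->]] := flow_semigroup x (sb n) bT.
apply: (le_trans (flow_lipschitz _ _ bT)).
have Is : `|\int[mu]_(r in `[s n, b]) `|F r x| | <= e / L.
  move: b1s (sb n); near: n; exact: nearI.
have := ode_initial_growth K0 lipF intF su (r := b).
rewrite sb lexx us distrC => /(_ isT) h.
have {}h : `|x - u b| <= 2 * (e / L) * expR (2 * K * 1).
  apply: (le_trans h); apply: ler_pM.
  - by rewrite mulr_ge0// Rintegral_ge0.
  - exact: expR_ge0.
  - by rewrite ler_wpM2l//; exact: le_trans (ler_norm _) Is.
  - by rewrite ler_expR ler_wpM2l ?mulr_ge0 ?(ltW K0)// lerBlDr addrC -lerBlDr ltW.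
have {}h := ler_wpM2l (_ : 0 <= 2 * expR (2 * K * (T - b))) h.
apply: (le_trans (h _)); first by rewrite mulr_ge0// expR_ge0.
have -> q : 2 * expR (2 * K * (T - b)) * (2 * q * expR (2 * K * 1)) = L * q.
  by rewrite /L; ring.
by rewrite mulrC divfK// gt_eqF.
Unshelve. all: by end_near. Qed.

End flow.

(** * First-order expansion of solutions at Lebesgue points *)

Section lebesgue_points.
Context {R : realType}.
Local Notation mu := (@lebesgue_measure R).

Lemma lebesgue_pt_right (h : R -> R) (s : R) :
  mu.-integrable setT (EFin \o h) -> lebesgue_pt h s ->
  forall e, 0 < e -> exists2 d, 0 < d & forall t, s <= t -> t < s + d ->
  \int[mu]_(v in `[s, t]) `|h v - h s| <= e * (t - s).
Proof.
move=> ih /fine_cvgP[fins cvs] e e0.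
have e40 : 0 < e / 4 by rewrite divr_gt0.
have : \forall r \near (0 : R)^'+, (davg h s r <= (e / 4)%:E)%E.
  near=> r.
  have finr : davg h s r \is a fin_num by near: r.
  rewrite -(fineK finr) lee_fin.
  near: r; move/cvgrPdist_le : cvs => /(_ _ e40); apply: filterS => r /=.
  by rewrite sub0r normrN; apply: le_trans; exact: ler_norm.
rewrite near_withinE => /nbhs_ballP[d /= d0 dP].
exists (d / 2); first by rewrite divr_gt0.
move=> t; rewrite le_eqVlt => /predU1P[<- _|st tsd].
  by rewrite set_itv1 Rintegral_set1 subrr mulr0.
(* The open ball of radius [t - s] would miss [t]. Radius [2 * (t - s)] covers the segment and has
   measure [4 * (t - s)], which explains [e / 4] and [d / 2]. *)
pose r := 2 * (t - s).
have r0 : 0 < r by rewrite mulr_gt0// subr_gt0.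
have := dP r; rewrite /ball/= sub0r normrN gtr0_norm// => /(_ _ r0).
have -> : r < d by rewrite /r; lra.
move=> /(_ isT).
rewrite /davg /iavg (lebesgue_measure_ball _ (ltW r0)) inver mulrn_eq0/= gt_eqF//.
rewrite lee_pdivrMl ?mulrn_wgt0// => Ile.
have ic : mu.-integrable (ball s r) (EFin \o (fun v => h v - h s)).
  have mb : measurable (ball s r) by exact: measurable_ball.
  have := @integrableB _ _ _ mu _ mb (EFin \o h) (EFin \o cst (h s)).
  apply; first exact: integrableS ih.
  rewrite ball_itv; apply: integrableS (integrable_itv_cst (s - r) (s + r) (h s)) => //.
  exact: subset_itv_oo_cc.
have ist : mu.-integrable `[s, t] (EFin \o (fun v => `|h v - h s|)).
  apply: integrable_norm; apply: integrableS ic => //.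
    by rewrite ball_itv.
  rewrite ball_itv => v; rewrite /= !in_itv/= => /andP[sv vt]; rewrite /r.
  apply/andP; split; lra.
rewrite -lee_fin /Rintegral fineK; last exact: integrable_fin_num.
apply: le_trans (_ : _ <= \int[mu]_(v in ball s r) (`|h v - h s|)%:E)%E _.
  apply: ge0_subset_integral => //.
  - exact: measurable_ball.
  - apply/measurable_EFinP/measurableT_comp => //.
    by apply/measurable_EFinP; exact: measurable_int ic.
  - rewrite ball_itv => v; rewrite /= !in_itv/= => /andP[sv vt]; rewrite /r.
    apply/andP; split; lra.
apply: (le_trans Ile).
rewrite -EFinM lee_fin /r -mulr_natr; nra.
Unshelve. all: by end_near. Qed.

Variables (F : R -> R -> R) (K : R).
Hypothesis K0 : 0 < K.
Hypothesis lipF : forall t x y, `|F t x - F t y| <= K * `|x - y|.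
Hypothesis intF : forall x, mu.-integrable setT (EFin \o F^~ x).

Definition field_lebesgue_pt s := forall x e, 0 < e ->
  exists2 d, 0 < d & forall t, s <= t -> t < s + d ->
  \int[mu]_(v in `[s, t]) `|F v x - F s x| <= e * (t - s).

(* By the Lipschitz condition, the countably many rational states suffice. *)
Lemma ae_field_lebesgue_pt : {ae mu, forall s, field_lebesgue_pt s}.
Proof.
have lq (q : rat) : {ae mu, forall s, lebesgue_pt (F^~ (ratr q)) s}.
  apply: lebesgue_differentiation.
  have := integrable_locally (@measurableT _ _) (intF (ratr q)).
  by rewrite patch_setT.
have : {ae mu, forall s, forall n,
    if unpickle n is Some q then lebesgue_pt (F^~ (@ratr R q)) s else True}.
  rewrite /almost_everywhere.
  apply: (@negligibleS _ _ _ mu (\bigcup_n ~` [set s |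
    if unpickle n is Some q then lebesgue_pt (F^~ (@ratr R q)) s else True])).
    by move=> s /= /existsNP[n ns]; exists n.
  apply: negligible_bigcup => n; case: (unpickle n) => [q|]; first exact: lq.
  apply: (@negligibleS _ _ _ mu set0); last exact: negligible_set0.
  by move=> s /=.
apply: filterS; first exact: (ae_filter_ringOfSetsType mu).
move=> s sP x e e0.
have r0 : 0 < e / (4 * K) by rewrite divr_gt0// mulr_gt0.
have [q xq] : exists q, `|x - ratr q| < e / (4 * K).
  suff : ball x (e / (4 * K)) `&` range ratr !=set0.
    by move=> [/= _ []] /[swap] -[y _ <-]; exists y.
  apply: dense_rat; last exact: ball_open.
  by exists x; exact: ballxx.
have := sP (pickle q); rewrite pickleK => qs.
have e20 : 0 < e / 2 by rewrite divr_gt0.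
have [d d0 dP] := lebesgue_pt_right (intF _) qs e20.
exists d => // t st td.
have iq := integrable_field intF (ratr q) s t.
have iqs : mu.-integrable `[s, t] (EFin \o (fun v => `|F v (ratr q) - F s (ratr q)|)).
  by apply: integrable_itv_norm; apply: integrable_itvB => //; exact: integrable_itv_cst.
apply: le_trans (_ : _ <= \int[mu]_(v in `[s, t])
    (`|F v (ratr q) - F s (ratr q)| + e / 2)) _.
  apply: le_Rintegral_itv.
  - apply: integrable_itv_norm; apply: integrable_itvB; last exact: integrable_itv_cst.
    exact: integrable_field intF _ _ _.
  - by apply: integrable_itvD => //; exact: integrable_itv_cst.
  - move=> v _.
    have -> : F v x - F s x = (F v (ratr q) - F s (ratr q)) +
      ((F v x - F v (ratr q)) - (F s x - F s (ratr q))) by ring.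
    apply: (le_trans (ler_normD _ _)); rewrite lerD2l.
    apply: (le_trans (ler_normB _ _)).
    have := lipF v x (ratr q); have := lipF s x (ratr q).
    move: xq; rewrite ltr_pdivlMr ?mulr_gt0//; nra.
rewrite RintegralD//; last exact: integrable_itv_cst.
rewrite Rintegral_itv_cst//.
have := dP _ st td; nra.
Qed.

(** The radius is chosen before [t] and [u], so it serves every solution that starts from [x] at
    time [s]. The solution moves by at most [2 * M * E * (t - s)]; freezing the state at [x]
    therefore costs a term quadratic in [t - s], which takes one half of [e], and the Lebesgue point
    property takes the other. *)
Lemma ode_expansion (s x e : R) : field_lebesgue_pt s -> 0 < e ->
  exists2 d, 0 < d & forall (t : R) u, s <= t -> t < s + d ->
  ode_solution F u s t -> u s = x ->
  `|u t - x - F s x * (t - s)| <= e * (t - s).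
Proof.
move=> sP e0.
have e20 : 0 < Num.min 1 (e / 2) by rewrite lt_min ltr01 divr_gt0.
have [d d0 dP] := sP x _ e20.
pose M := `|F s x| + 1.
pose E := expR (2 * K).
have M0 : 0 < M by rewrite ltr_wpDl.
have E0 : 0 < E by exact: expR_gt0.
pose d' := Num.min d (Num.min 1 (e / (4 * K * M * E))).
have D0 : 0 < 4 * K * M * E by rewrite !mulr_gt0.
have d'0 : 0 < d' by rewrite !lt_min d0 ltr01/= divr_gt0.
exists d' => // t u st td' su us.
have [td t1 tK] : [/\ t < s + d, t < s + 1 & (t - s) * (4 * K * M * E) <= e].
  move: td'; rewrite -!ltrBlDl /d' !lt_min => /and3P[-> ->].
  by rewrite ltr_pdivlMr// => /ltW.
have iFx := integrable_field intF x s t.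
have iFxs : mu.-integrable `[s, t] (EFin \o (fun v => `|F v x - F s x|)).
  by apply: integrable_itv_norm; apply: integrable_itvB => //; exact: integrable_itv_cst.
have h1 := dP _ st td.
have intM : \int[mu]_(v in `[s, t]) `|F v x| <= M * (t - s).
  apply: le_trans (_ : _ <= \int[mu]_(v in `[s, t]) (`|F v x - F s x| + `|F s x|)) _.
    apply: le_Rintegral_itv.
    - exact: integrable_itv_norm.
    - by apply: integrable_itvD => //; exact: integrable_itv_cst.
    - by move=> v _; have := ler_normD (F v x - F s x) (F s x); rewrite subrK.
  rewrite RintegralD//; last exact: integrable_itv_cst.
  rewrite Rintegral_itv_cst// /M.
  have : Num.min 1 (e / 2) <= 1 by rewrite ge_min lexx.
  nra.
have ur (r : R) : s <= r <= t -> `|u r - x| <= 2 * M * E * (t - s).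
  move=> /[dup] rst /andP[sr rt].
  have := ode_initial_growth K0 lipF intF su rst; rewrite us => /le_trans; apply.
  have Er : expR (2 * K * (r - s)) <= E.
    rewrite ler_expR -[leRHS]mulr1 ler_wpM2l ?mulr_ge0 ?(ltW K0)//; lra.
  have I0 : 0 <= \int[mu]_(v in `[s, t]) `|F v x| by exact: Rintegral_ge0.
  have Er0 := expR_ge0 (2 * K * (r - s)).
  have := ler_pM I0 Er0 intM Er; lra.
have iu := su.1.
rewrite (su.2 t) ?st ?lexx// us [x + _]addrC addrK.
have -> : F s x * (t - s) = \int[mu]_(v in `[s, t]) F s x.
  by rewrite Rintegral_itv_cst.
rewrite -RintegralB//; last exact: integrable_itv_cst.
have iB : mu.-integrable `[s, t] (EFin \o (fun v => F v (u v) - F s x)).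
  by apply: integrable_itvB => //; exact: integrable_itv_cst.
apply: (le_trans (le_normr_Rintegral _ iB)) => //.
apply: le_trans (_ : _ <= \int[mu]_(v in `[s, t])
    (`|F v x - F s x| + K * (2 * M * E * (t - s)))) _.
  apply: le_Rintegral_itv.
  - exact: integrable_itv_norm.
  - by apply: integrable_itvD => //; exact: integrable_itv_cst.
  - move=> v vst; rewrite -[F v (u v)](subrK (F v x)) -addrA addrC.
    apply: (le_trans (ler_normD _ _)); rewrite lerD2l.
    apply: (le_trans (lipF _ _ _)).
    by rewrite ler_wpM2l ?(ltW K0)// ur.
rewrite RintegralD//; last exact: integrable_itv_cst.
rewrite Rintegral_itv_cst//.
have : Num.min 1 (e / 2) <= e / 2 by rewrite ge_min lexx orbT.
have := ler_wpM2r (_ : 0 <= t - s) tK; rewrite subr_ge0 => /(_ st).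
have : 0 <= t - s by rewrite subr_ge0.
nra.
Qed.

End lebesgue_points.

(** * Preimages of null sets *)

Section negligible_preimage.
Context {R : realType}.
Local Notation mu := (@lebesgue_measure R).
Let l := @wlength R idfun.

(** Cover [B] by open intervals of small total length. The points of [E] sent into one of them lie
    within its length divided by [c] of each other, hence in a segment around any one of them of
    [2 / c] times that length. Everything takes place in outer measure, as [E] and [h] may be
    non-measurable. *)
Lemma negligible_bilipschitz_preimage (h : R -> R) (E B : set R) (c : R) :
  0 < c -> mu.-negligible B -> (forall s, E s -> B (h s)) ->
  (forall s t, E s -> E t -> c * `|t - s| <= `|h t - h s|) ->
  mu.-negligible E.
Proof.
move=> c0 nB EB hE; apply/negligible_outer_measure/eqP.
rewrite eq_le outer_measure_ge0 andbT; apply/lee_addgt0Pr => e e0; rewrite add0e.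
have ce0 : 0 < c / 2 * e by rewrite mulr_gt0// divr_gt0.
have [F BF Fe] : exists2 I_, open_itv_cover B I_ &
    (\sum_(0 <= k <oo) l (I_ k) <= (c / 2 * e)%:E)%E.
  have := (@negligible_outer_measure R B).1 nB.
  rewrite outer_measure_open_itv_cover => inf0.
  have : ereal_inf [set (\sum_(k <oo) l (F k))%E | F in open_itv_cover B]
    \is a fin_num by rewrite inf0.
  move=> /lb_ereal_inf_adherent-/(_ _ ce0)[_/= [F]] BF <-.
  by rewrite inf0 add0e => Fe; exists F => //; exact/ltW.
pose G k := E `&` h @^-1` (F k).
have EG : E `<=` \bigcup_k G k.
  by move=> s Es; have [k _ Fk] := BF.2 _ (EB _ Es); exists k.
apply: (@le_trans _ _ ((l^*)%mu (\bigcup_k G k))); first exact: le_outer_measure.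
apply: (le_trans (outer_measure_sigma_subadditive (l^*)%mu G)).
apply: (@le_trans _ _ (\sum_(0 <= k <oo) ((2 / c)%:E * l (F k)))%E); last first.
  rewrite nneseriesZl; last by move=> k _; exact: wlength_ge0.
  apply: (@le_trans _ _ ((2 / c)%:E * (c / 2 * e)%:E)%E).
    by rewrite lee_wpmul2l// lee_fin divr_ge0// ltW.
  rewrite -EFinM lee_fin (_ : 2 / c * (c / 2 * e) = e)//.
  by field; rewrite gt_eqF.
apply: lee_nneseries => // k _.
have [[a b] Fab] := BF.1 k.
have [[s Gs]|noG] := pselect (exists s, G k s); last first.
  have -> : G k = set0 by apply/seteqP; split => // s Gs; apply: noG; exists s.
  by rewrite outer_measure0 mule_ge0// ?lee_fin ?divr_ge0 ?(ltW c0).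
have /andP[ahs hsb] : a < h s < b by have := Gs.2; rewrite /= Fab/= in_itv.
have ab := lt_trans ahs hsb.
pose L := (b - a) / c.
have L0 : 0 <= L by rewrite divr_ge0 ?(ltW c0)// subr_ge0 ltW.
have GL : G k `<=` `[s - L, s + L].
  move=> t [Et]; rewrite /= Fab/= !in_itv/= => /andP[aht htb].
  have := hE _ _ Gs.1 Et.
  have hab : `|h t - h s| <= b - a by rewrite ler_norml; apply/andP; split; lra.
  move=> /le_trans /(_ hab); rewrite mulrC -ler_pdivlMr// -/L ler_norml; lra.
apply: (@le_trans _ _ ((l^*)%mu `[s - L, s + L])); first exact: le_outer_measure.
rewrite -[leLHS]/(mu `[s - L, s + L]) lebesgue_measure_itv Fab /l wlength_itv/=.
rewrite !lte_fin ab; case: ifPn => [_|]; last first.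
  by rewrite mule_ge0// -?EFinB lee_fin ?divr_ge0 ?(ltW c0)// subr_ge0 ltW.
by rewrite -!EFinB -EFinM lee_fin (_ : 2 / c * (b - a) = L + L) /L; [lra|lra].
Qed.

Lemma negligible_bigcup_countable (I : countType) (E : I -> set R) :
  (forall i, mu.-negligible (E i)) -> mu.-negligible (\bigcup_i E i).
Proof.
move=> nE; pose E' n := if unpickle n is Some i then E i else set0.
apply: (@negligibleS _ _ _ mu (\bigcup_n E' n)).
  by move=> s [i _ Eis]; exists (pickle i) => //; rewrite /E' pickleK.
apply: negligible_bigcup => n; rewrite /E'.
by case: unpickle => [i|]; [exact: nE|exact: negligible_set0].
Qed.

(** In windows of length [d / 2] any two points are closer than [d], so the local lower bound
    becomes a global one on each window. *)
Lemma negligible_locally_expansive_preimage (h : R -> R) (E B : set R) (c d : R) :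
  0 < c -> 0 < d -> mu.-negligible B -> (forall s, E s -> B (h s)) ->
  (forall s t, E s -> E t -> s < t -> t < s + d ->
    c * (t - s) <= `|h t - h s|) ->
  mu.-negligible E.
Proof.
move=> c0 d0 nB EB hE.
pose Ek (k : int) := E `&` `[k%:~R * (d / 2), (k + 1)%:~R * (d / 2)]%classic.
apply: (@negligibleS _ _ _ mu (\bigcup_k Ek k)).
  move=> s Es; exists (Num.floor (s / (d / 2))) => //; split => //=.
  have d20 : 0 < d / 2 by rewrite divr_gt0.
  have := floor_le_tmp (s / (d / 2)); have := floorD1_gt (s / (d / 2)).
  rewrite ler_pdivlMr// ltr_pdivrMr// in_itv/= => h1 h2.
  by rewrite h2 ltW.
apply: negligible_bigcup_countable => k.
apply: (negligible_bilipschitz_preimage c0 nB (h := h)).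
  by move=> s [Es _]; exact: EB.
have expand s t : Ek k s -> Ek k t -> s < t -> c * (t - s) <= `|h t - h s|.
  rewrite /Ek /= !in_itv/= intrD1 => -[Es /andP[ks sk]] [Et /andP[kt tk]] st.
  apply: hE => //; lra.
move=> s t Es Et; case: (ltgtP s t) => [st|ts|->]; last first.
- by rewrite !subrr normr0 mulr0.
- rewrite ltr0_norm ?subr_lt0// opprB [`|h t - _|]distrC; exact: expand.
- by rewrite [`|t - s|]gtr0_norm ?subr_gt0//; exact: expand.
Qed.

End negligible_preimage.

(* The data g is only separately differentiable, and gx need not be continuous in
   time. Along the curve z the increment of g is split through g(t, z(s)): gx is
   then evaluated at the later time and gt at the earlier one, and the two slopes
   gx(s, z(s)), gx(t, z(t)) agree up to e because a piece only contains times at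
   which gx(s, z(s)) / e has a prescribed integer part. The pieces need not be
   measurable. *)
Section exceptional_times.
Context {R : realType}.
Local Notation mu := (@lebesgue_measure R).
Variables (F : R -> R -> R) (K T : R).
Hypothesis K0 : 0 < K.
Hypothesis mF : measurable_fun setT (fun z : R * R => F z.1 z.2).
Hypothesis lipF : forall t x y, `|F t x - F t y| <= K * `|x - y|.
Hypothesis intF : forall x, mu.-integrable setT (EFin \o F^~ x).
Variables (g gx gt : R -> R -> R).
Hypothesis g_space : forall t x e, 0 <= t <= T -> 0 < e ->
  exists2 d, 0 < d & forall y, `|y - x| < d ->
  `|g t y - g t x - gx t x * (y - x)| <= e * `|y - x|.
Hypothesis g_time : forall t x e, 0 <= t <= T -> 0 < e ->
  exists2 d, 0 < d & forall s, 0 <= s <= T -> `|s - t| < d ->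
  `|g s x - g t x - gt t x * (s - t)| <= e * `|s - t|.
Hypothesis phi_neq0 : forall t x, 0 <= t <= T ->
  F t (x + g t x) - F t x - gx t x * F t x - gt t x != 0.
Variables (L B : set R) (z : R -> R).
Hypothesis LT : forall s, L s -> 0 <= s <= T.
Hypothesis Lsol : forall s t, L s -> L t -> s < t -> ode_solution F z s t.
Hypothesis nB : mu.-negligible B.

Let y s := z s + g s (z s).
Let ph s := F s (y s) - F s (z s) - gx s (z s) * F s (z s) - gt s (z s).

(** One radius [d] for the four expansions at time [s]: the path, the solution started from the
    post-jump state [y s], [g] in space and [g] in time. Prescribing [d] makes them uniform over a
    piece. *)
Let expanding (s e d : R) :=
  [/\ forall t u, s <= t -> t < s + d -> ode_solution F u s t -> u s = z s ->
        `|u t - z s - F s (z s) * (t - s)| <= e * (t - s),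
      forall t u, s <= t -> t < s + d -> ode_solution F u s t -> u s = y s ->
        `|u t - y s - F s (y s) * (t - s)| <= e * (t - s),
      forall x, `|x - z s| < d ->
        `|g s x - g s (z s) - gx s (z s) * (x - z s)| <= e * `|x - z s| &
      forall t, 0 <= t <= T -> `|t - s| < d ->
        `|g t (z s) - g s (z s) - gt s (z s) * (t - s)| <= e * `|t - s|].

Let expandingP s e : 0 <= s <= T -> field_lebesgue_pt F s -> 0 < e ->
  exists2 d, 0 < d & forall d', d' <= d -> expanding s e d'.
Proof.
move=> sT sP e0.
have [d1 d10 d1P] := ode_expansion K0 lipF intF (z s) sP e0.
have [d2 d20 d2P] := ode_expansion K0 lipF intF (y s) sP e0.
have [d3 d30 d3P] := g_space (z s) sT e0.
have [d4 d40 d4P] := g_time (z s) sT e0.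
exists (Num.min (Num.min d1 d2) (Num.min d3 d4)).
  by rewrite !lt_min d10 d20 d30.
move=> d'; rewrite !le_min => /andP[/andP[l1 l2] /andP[l3 l4]]; split.
- move=> t u st td; apply: d1P => //; lra.
- move=> t u st td; apply: d2P => //; lra.
- by move=> x xd; apply: d3P; exact: lt_le_trans l3.
- by move=> t tT td; apply: d4P => //; exact: lt_le_trans l4.
Qed.

(** Here [u t - y t] is [(t - s) * ph s] plus six remainders. As [e <= 1 <= M], they total at most
    [7 * M * e * (t - s)], and the choice of [e] makes this half of the lower bound
    [M^-1 * (t - s)]. The restriction of [t - s] to [d / (2 * M)] keeps [z s] within [d] of [z t],
    since the path moves at speed at most [M + e]. Transport by the flow from [t] to [T] costs the
    exponential factor. *)
Let piece_estimate (s t M e d : R) : L s -> L t -> s < t ->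
  1 <= M -> e = (14 * M ^+ 2)^-1 -> t < s + d / (2 * M) -> 0 < d ->
  `|F s (z s)| <= M -> `|gx t (z t)| <= M -> M^-1 <= `|ph s| ->
  `|gx t (z t) - gx s (z s)| <= e -> expanding s e d -> expanding t e d ->
  (2 * M)^-1 * (2 * expR (2 * K * T))^-1 * (t - s) <=
  `|flow F T t (y t) - flow F T s (y s)|.
Proof.
move=> Ls Lt st M1 eE tsd d0 aM pM phM pe [zs ys _ gs] [_ _ gxt _].
have M0 : 0 < M by exact: lt_le_trans M1.
have tau0 : 0 < t - s by rewrite subr_gt0.
have e0 : 0 < e by rewrite eE invr_gt0 mulr_gt0// exprn_gt0.
have eM : 14 * M * e = M^-1 by rewrite eE; field; rewrite gt_eqF.
have e1 : e <= 1.
  rewrite eE invf_le1 ?mulr_gt0 ?exprn_gt0//; nra.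
have dM : d / (2 * M) <= d by rewrite ler_pdivrMr ?mulr_gt0//; nra.
have td : t < s + d by lra.
have [/andP[s0 sT] /andP[t0 tT]] := (LT Ls, LT Lt).
have [u [su us uE]] := flow_semigroup K0 mF lipF intF (y s) (ltW st) tT.
have h1 := ys _ _ (ltW st) td su us.
have h2 := zs _ _ (ltW st) td (Lsol Ls Lt st) erefl.
have h2' : `|z t - z s| <= (M + e) * (t - s).
  have := ler_normD (z t - z s - F s (z s) * (t - s)) (F s (z s) * (t - s)).
  rewrite subrK normrM [`|t - s|]gtr0_norm//.
  have := ler_wpM2r (ltW tau0) aM; lra.
have zd : `|z s - z t| < d.
  rewrite distrC; apply: (le_lt_trans h2').
  have : (t - s) * (2 * M) < d by rewrite -ltr_pdivlMr ?mulr_gt0// ltrBlDl.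
  nra.
have h3 := gxt _ zd.
have h4 : `|g t (z s) - g s (z s) - gt s (z s) * (t - s)| <= e * (t - s).
  by rewrite -{2}[t - s]gtr0_norm//; apply: gs; rewrite ?t0// gtr0_norm// ltrBlDl.
have h5 : (2 * M)^-1 * (t - s) <= `|u t - y t|.
  set e1' := u t - _ - _ in h1; set e2 := z t - _ - _ in h2.
  set e3 := _ - _ - _ in h3; set e4 := _ - _ - _ in h4.
  pose W := - ((gx t (z t) - gx s (z s)) * F s (z s) * (t - s)) -
    gx t (z t) * e2 + e1' - e2 + e3 - e4.
  have E : u t - y t = (t - s) * ph s + W.
    by rewrite /W /e1' /e2 /e3 /e4 /ph /y; ring.
  have k1 : `|(gx t (z t) - gx s (z s)) * F s (z s) * (t - s)| <= e * M * (t - s).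
    by rewrite !normrM [`|t - s|]gtr0_norm// ler_wpM2r ?(ltW tau0)// ler_pM.
  have k2 : `|gx t (z t) * e2| <= M * (e * (t - s)) by rewrite normrM ler_pM.
  have k3 : `|e3| <= e * ((M + e) * (t - s)).
    by apply: (le_trans h3); rewrite distrC ler_wpM2l// ltW.
  rewrite E.
  have : `|W| <= 7 * M * e * (t - s).
    apply: le_trans (_ : _ <= e * M * (t - s) + M * (e * (t - s)) + e * (t - s)
      + e * (t - s) + e * ((M + e) * (t - s)) + e * (t - s)) _.
      apply: (le_trans (ler_normB _ _)); apply: lerD => //.
      apply: (le_trans (ler_normD _ _)); apply: lerD => //.
      apply: (le_trans (ler_normB _ _)); apply: lerD => //.
      apply: (le_trans (ler_normD _ _)); apply: lerD => //.
      by apply: (le_trans (ler_normB _ _)); apply: lerD => //; rewrite normrN.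
    have := mulr_gt0 e0 tau0; nra.
  have -> : 7 * M * e * (t - s) = (2 * M)^-1 * (t - s).
    by rewrite -[7]/(7%:R) invfM -eM; field.
  have : `|(t - s) * ph s| >= M^-1 * (t - s).
    by rewrite normrM gtr0_norm// mulrC ler_wpM2l// ltW.
  have := ler_normD ((t - s) * ph s + W) (- W).
  rewrite addrK normrN.
  have : (2 * M)^-1 * (t - s) + (2 * M)^-1 * (t - s) = M^-1 * (t - s).
    by field; rewrite gt_eqF.
  lra.
have := flow_expansive K0 mF lipF intF (u t) (y t) tT.
rewrite -uE [`|flow _ _ s _ - _|]distrC => h6.
have C0 : 0 < 2 * expR (2 * K * T) by rewrite mulr_gt0// expR_gt0.
have h7 : 2 * expR (2 * K * (T - t)) <= 2 * expR (2 * K * T).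
  by rewrite ler_wpM2l// ler_expR ler_wpM2l ?mulr_ge0 ?(ltW K0)//; lra.
rewrite mulrAC ler_pdivrMr//; apply: (le_trans h5); apply: (le_trans h6).
by rewrite mulrC ler_wpM2l.
Qed.

Lemma exceptional_times_negligible : mu.-negligible
  (L `&` [set s | B (flow F T s (z s + g s (z s)))]).
Proof.
pose Mm (m : nat) : R := m.+1%:R.
pose em m : R := (14 * Mm m ^+ 2)^-1.
pose dk (k : nat) : R := k.+1%:R^-1.
(* The index [m] bounds the drift, the slope of [g] and the inverse of [|ph s|], [k] fixes the
   radius, and [j] locates the slope up to [em m]. A suitable [m] exists at every time of [L]
   because [ph s] is nonzero there; a suitable [k] exists at Lebesgue points. *)
pose E (i : nat * nat * int) := let: (m, k, j) := i in
  [set s | [/\ L s, B (flow F T s (y s)), `|F s (z s)| <= Mm m &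
    `|gx s (z s)| <= Mm m] /\ [/\ (Mm m)^-1 <= `|ph s|, expanding s (em m) (dk k) &
    Num.floor (gx s (z s) / em m) = j]].
apply: (@negligibleS _ _ _ mu
  ((~` [set s | field_lebesgue_pt F s]) `|` \bigcup_i E i)).
  move=> s [Ls Bs]; have [sP|sP] := pselect (field_lebesgue_pt F s); last by left.
  right.
  pose m := Num.truncn (`|F s (z s)| + `|gx s (z s)| + `|ph s|^-1).
  have ph0 : 0 < `|ph s| by rewrite normr_gt0; exact: phi_neq0 (LT Ls).
  have mM : `|F s (z s)| + `|gx s (z s)| + `|ph s|^-1 < Mm m.
    exact: truncnS_gt.
  have e0 : 0 < em m by rewrite invr_gt0 mulr_gt0// exprn_gt0// ltr0Sn.
  have [d d0 dP] := expandingP (LT Ls) sP e0.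
  have [k kd] : exists k, dk k <= d.
    exists (Num.truncn d^-1); rewrite /dk invf_ple ?posrE// ltW//.
    exact: truncnS_gt.
  exists (m, k, Num.floor (gx s (z s) / em m)) => //=.
  have i0 : 0 < `|ph s|^-1 by rewrite invr_gt0.
  have n1 := normr_ge0 (F s (z s)); have n2 := normr_ge0 (gx s (z s)).
  split; split => //; try lra; last exact: dP.
  by rewrite invf_ple ?posrE ?ltr0Sn//; lra.
apply: negligibleU; first exact: ae_field_lebesgue_pt K0 lipF intF.
apply: negligible_bigcup_countable => -[[m k] j].
have M0 : 0 < Mm m by rewrite ltr0Sn.
have e0 : 0 < em m by rewrite invr_gt0 mulr_gt0// exprn_gt0.
have C0 : 0 < 2 * expR (2 * K * T) by rewrite mulr_gt0// expR_gt0.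
apply: (@negligible_locally_expansive_preimage _ (fun s => flow F T s (y s)) _ B
  ((2 * Mm m)^-1 * (2 * expR (2 * K * T))^-1) (dk k / (2 * Mm m))) => //.
- by rewrite mulr_gt0// invr_gt0// mulr_gt0.
- by rewrite divr_gt0 ?invr_gt0 ?mulr_gt0.
- by move=> s [[]].
- move=> s t [[Ls Bs aM pM] [phM ex sj]] [[Lt Bt aMt pMt] [phMt ext tj]] st td.
  apply: (@piece_estimate s t (Mm m) (em m) (dk k)) => //.
  + by rewrite ler1n.
  + by rewrite invr_gt0.
  + have := floor_le_tmp (gx s (z s) / em m); have := floorD1_gt (gx s (z s) / em m).
    have := floor_le_tmp (gx t (z t) / em m); have := floorD1_gt (gx t (z t) / em m).
    rewrite sj tj !ler_pdivlMr// !ltr_pdivrMr// intrD1 !mulrDl mul1r ler_norml.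
    by move=> *; apply/andP; split; lra.
Qed.

End exceptional_times.

(** * Counting paths and the equation along a path *)

Section non_measurable_integrals.
Context d (U : measurableType d) {R : realType}.
Variable m : {measure set U -> \bar R}.
Local Open Scope ereal_scope.

Import HBNNSimple.

(* No measurability of [f] is required in the next two lemmas: the integral is
   a supremum over the simple functions below [f]. *)
Lemma integral_null_support (D N : set U) (f : U -> \bar R) :
  measurable N -> m N = 0 -> (forall x, D x -> ~ N x -> f x = 0) ->
  \int[m]_(x in D) f x = 0.
Proof.
move=> mN N0 f0.
have ge0_case (h : U -> \bar R) : (forall x, 0 <= h x) ->
    (forall x, ~ N x -> h x = 0) -> \int[m]_x h x = 0.
  move=> h0 hN; apply/eqP; rewrite eq_le integral_ge0// andbT.
  rewrite ge0_integralTE//; apply: ge_ereal_sup => _ [k /= kh <-].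
  have <- : \int[m]_x (k x)%:E = sintegral m k.
    by rewrite integral_nnsfun//; congr sintegral; exact: patch_setT.
  rewrite (@ge0_ae_eq_integral _ _ _ m setT _ (cst 0)) ?integral0//.
  - exact/measurable_EFinP.
  - by move=> x _; rewrite lee_fin.
  - exists N; split => // x /= /not_implyP[_ kx0]; apply: contrapT => Nx.
    apply: kx0; apply/eqP; rewrite eq_le; apply/andP; split.
      by rewrite -(hN _ Nx).
    by rewrite lee_fin.
rewrite integral_mkcond integralE !ge0_case ?sube0// => x Nx.
- rewrite funenegE patchE; case: ifPn => [/set_mem Dx|_].
    by rewrite f0// oppe0 maxxx.
  by rewrite oppe0 maxxx.
- rewrite funeposE patchE; case: ifPn => [/set_mem Dx|_]; last by rewrite maxxx.
  by rewrite f0// maxxx.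
Qed.

Lemma measure_le_integral (D A : set U) (f : U -> \bar R) :
  measurable A -> A `<=` D -> (forall x, D x -> 0 <= f x) ->
  (forall x, A x -> 1 <= f x) -> m A <= \int[m]_(x in D) f x.
Proof.
move=> mA AD f0 f1; rewrite -(sintegral_indic m A) ge0_integralE//.
apply: ereal_sup_ubound; exists (indic_nnsfun R mA) => //= x.
rewrite /mindic indicE patchE; case: ifPn => [/set_mem Dx|/negP Dx].
  by case: (boolP (x \in A)) => [/set_mem Ax|_]; [exact: f1|exact: f0].
by rewrite memNset// => /AD; move/mem_set.
Qed.

End non_measurable_integrals.

Lemma locally_bounded_segment {R : realType} (a b : R) (h : R -> R) :
  (forall t, a <= t <= b -> exists d M, 0 < d /\
    (forall s, a <= s <= b -> `|s - t| < d -> `|h s| <= M)) ->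
  exists2 M, 0 <= M & forall s, a <= s <= b -> `|h s| <= M.
Proof.
move=> locb.
have : \forall M \near +oo, `[a, b] `<=` [set s | a <= s <= b -> `|h s| <= M].
  apply: (compact_near_coveringP `[a, b]).1; first exact: segment_compact.
  move=> t; rewrite /= in_itv/= => /locb[d [M [d0 dM]]].
  exists (ball t d, [set M' | M <= M']) => /=.
    by split; [exact: nbhsx_ballx|exact: nbhs_pinfty_ge (num_real _)].
  move=> [s M'] /= [sd MM'] sab; apply: (le_trans _ MM'); apply: dM => //.
  by rewrite distrC.
move=> nearM; near (pinfty_nbhs R) => M.
exists M => // s sab.
have : `[a, b] `<=` [set s | a <= s <= b -> `|h s| <= M] by near: M.
by move=> /(_ s); rewrite /= in_itv/=; exact.
Unshelve. all: by end_near. Qed.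

Section counting_measure_of_a_path.
Context {R : realType}.
Implicit Types (w : canonical_space R) (a b : R) (h : R -> R).

Lemma dN_itv w a b : a <= b -> dN w `]a, b]%classic = (w b - w a)%:E.
Proof.
move=> ab; rewrite /dN/= /lebesgue_stieltjes_measure/= /measure_extension/=.
by rewrite measurable_mu_extE/= ?wlength_itv_bnd//; exact: is_ocitv.
Qed.

Lemma integrable_dN w a b h M : measurable_fun `]a, b] h ->
  (forall s, a < s <= b -> `|h s| <= M) ->
  (dN w).-integrable `]a, b] (EFin \o h).
Proof.
move=> mh hM; apply: measurable_bounded_integrable => //.
- have [ab|ba] := leP a b; first by rewrite dN_itv// ltry.
  by rewrite set_itv_ge ?measure0// bnd_simp -leNgt ltW.
- exists M; split; first exact: num_real.
  move=> M' MM' s /=; rewrite in_itv/= => sab.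
  exact: le_trans (hM _ sab) (ltW MM').
Qed.

Lemma Rintegral_dN_chasles w a b c h : a <= c -> c <= b ->
  (dN w).-integrable `]a, b] (EFin \o h) ->
  \int[dN w]_(s in `]a, b]) h s =
  \int[dN w]_(s in `]a, c]) h s + \int[dN w]_(s in `]c, b]) h s.
Proof.
move=> ac cb ih.
have E : `]a, b]%classic = `]a, c] `|` `]c, b].
  by rewrite -itv_bndbnd_setU// bnd_simp.
rewrite [in LHS]E Rintegral_setU//; first by rewrite -E.
by apply/disj_setPS => s []; rewrite /= !in_itv/= => /andP[_ sc] /andP[/lt_geF]; rewrite sc.
Qed.

Lemma Rintegral_dN_null w (D : set (measurableTypeR R)) h : measurable D ->
  dN w D = 0%E -> \int[dN w]_(s in D) h s = 0.
Proof.
by move=> mD D0; rewrite /Rintegral (@integral_null_support _ _ R (dN w) _ D).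
Qed.

Lemma Rintegral_dN_atom w a b h : a < b ->
  dN w `]a, b[%classic = 0%E -> dN w [set b] = 1%E ->
  (dN w).-integrable `]a, b] (EFin \o h) ->
  \int[dN w]_(s in `]a, b]) h s = h b.
Proof.
move=> ab d0 d1 ih.
have E : `]a, b]%classic = `]a, b[ `|` [set b] by rewrite setUitv1// bnd_simp.
rewrite E Rintegral_setU//; last 2 first.
- by rewrite -E.
- apply/disj_setPS => s []/= + sb; rewrite in_itv/= sb ltxx andbF//.
rewrite Rintegral_dN_null// add0r.
rewrite (@eq_Rintegral _ _ _ _ _ (cst (h b))).
  by rewrite Rintegral_cst// d1 mulr1.
by move=> s; rewrite inE/= => ->.
Qed.

Lemma path_mono w s t : s <= t -> w s <= w t.
Proof. exact: path_nondecreasing. Qed.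

Lemma path_gap w s t : w s < w t -> w s + 1 <= w t.
Proof.
have /natrP[n ->] := path_nat w s; have /natrP[m ->] := path_nat w t.
by rewrite ltr_nat natr1 ler_nat.
Qed.

Lemma last_jump w T : 0 < T -> 1 <= w T -> exists r t,
  [/\ 0 <= r, r < t, t <= T, w t = w T &
   [/\ dN w `]r, t[%classic = 0%E, dN w [set t] = 1%E &
    forall s, r <= s -> s < t -> w s = w r]].
Proof.
move=> T0 wT1.
pose E := [set s | w s < w T].
have E0 : E 0 by rewrite /E/= path_start//; exact: lt_le_trans wT1.
have ubE : ubound E T.
  by move=> s Es; rewrite leNgt; apply/negP => /ltW/(path_mono w); rewrite leNgt Es.
have hE : has_sup E by split; [exists 0|exists T].
pose t := sup E.
have tT : t <= T by apply: ge_sup => //; exists 0.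
have t0 : 0 <= t by apply: ub_le_sup => //; exists T.
have gtE s : t < s -> w T <= w s.
  move=> ts; rewrite leNgt; apply/negP => Es.
  by have := ub_le_sup hE.2 Es; rewrite leNgt ts.
have ltE s : s < t -> w s < w T.
  move=> st; have ts0 : 0 < t - s by rewrite subr_gt0.
  have [x Ex xs] := sup_adherent ts0 hE; rewrite subKr in xs.
  exact: le_lt_trans (path_mono w (ltW xs)) Ex.
have wt : w t = w T.
  apply/eqP; rewrite eq_le path_mono//=.
  apply: (cvgr_to_ge (@path_right_continuous _ w t)).
  by near=> s; apply: gtE; near: s; exact: nbhs_right_gt.
have {}t0 : 0 < t.
  rewrite lt_neqAle t0 andbT; apply/eqP => t00.
  by move: wT1; rewrite -wt -t00 path_start// ler10.
have [r [r0 rt wr]] : exists r, [/\ 0 <= r, r < t & w r + 1 = w T].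
  apply: contrapT => nr.
  have w2 s : 0 <= s -> s < t -> w s <= w T - 2.
    move=> s0 st; have ws1 := path_gap (ltE _ st).
    have : w s + 1 != w T by apply/eqP => E1; apply: nr; exists s.
    have /natrP[n En] := path_nat w s; have /natrP[m Em] := path_nat w T.
    move: ws1; rewrite En Em natr1 ler_nat eqr_nat => n1 n2.
    have : (n.+2 <= m)%N by rewrite ltn_neqAle n2.
    by rewrite -(ler_nat R) -[n.+2]addn2 natrD; lra.
  have : left_lim w t <= w T - 2.
    apply: limr_le.
      apply: nondecreasing_at_left_is_cvgr.
        by apply: nearW => x a b _ _; exact: path_mono.
      by apply: nearW => x; exists (w t) => _ [y + <-];
        rewrite /= in_itv/= => /andP[_ /ltW]; exact: path_mono.
    near=> s; apply: w2; near: s; last exact: nbhs_left_lt.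
    exact: nbhs_left_ge.
  have := path_unit_jump w t; rewrite wt; lra.
have wrs s : r <= s -> s < t -> w s = w r.
  move=> rs st; have := path_gap (ltE _ st); have := path_mono w rs.
  by move=> h1 h2; apply/eqP; rewrite eq_le h1 andbT; lra.
have d0 : dN w `]r, t[%classic = 0%E.
  apply/negligibleP; first exact: measurable_itv.
  rewrite itv_bnd_open_bigcup//; apply: negligible_bigcup => k.
  apply/negligibleP; first exact: measurable_itv.
  have [rk|kr] := leP r (t - k.+1%:R^-1); last first.
    by rewrite set_itv_ge ?measure0// bnd_simp -leNgt ltW.
  apply: etrans (dN_itv w rk) _.
  by rewrite wrs ?subrr// ltrBlDr ltrDl invr_gt0.
exists r, t; split => //; split => //.
have : dN w `]r, t]%classic = 1%E.
  by rewrite dN_itv ?(ltW rt)// wt -wr addrAC subrr add0r.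
have -> : `]r, t]%classic = `]r, t[ `|` [set t] by rewrite setUitv1// bnd_simp.
rewrite measureU//; last first.
  by apply/seteqP; split => // s []/= + st; rewrite in_itv/= st ltxx andbF.
by rewrite [X in (X + _)%E](_ : _ = 0%E)// add0e.
Unshelve. all: by end_near. Qed.

End counting_measure_of_a_path.

(** [tau z] is approached along the largest multiple of [1 / (n + 1)] strictly below it. This grid
    time is constant on slabs [a < tau z <= b], where only [Y a] is read. The lemma serves for left
    limits along one path, for the flow as a function of time and state, and, over the predictable
    sigma-algebra, for adapted processes. *)
Lemma measurable_left_limit {d} {U : measurableType d} {R : realType}
    (D : set U) (tau : U -> R) (Y : R -> U -> R) (l : U -> R) :
  measurable D -> (forall z, D z -> 0 < tau z) ->
  (forall a b B, 0 <= a -> a < b -> measurable B ->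
    measurable (D `&` [set z | a < tau z <= b] `&` Y a @^-1` B)) ->
  (forall z, D z -> forall s : nat -> R, (forall n, 0 <= s n < tau z) ->
    s @ \oo --> tau z -> Y (s n) z @[n --> \oo] --> l z) ->
  measurable_fun D l.
Proof.
move=> mD tau0 mY cY.
(* [Num.ceil x - 1] rather than the floor: when [tau z] is itself a grid time, the approximation
   must remain strictly below it. *)
pose k (x : R) := absz (Num.ceil x - 1).
have kP x : 0 < x -> (k x)%:R < x <= (k x).+1%:R.
  move=> x0; have c0 : 0 < Num.ceil x by rewrite ceil_gt0.
  have := ceil_itv x; rewrite /k.
  have [n ->] : exists n : nat, Num.ceil x = n.+1%:Z.
    by case: (Num.ceil x) c0 => [[//|n]|//] _; exists n.
  have -> : n.+1%:Z - 1 = n%:Z by rewrite -addn1 PoszD addrK.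
  by rewrite absz_nat.
have kU x n : n%:R < x <= n.+1%:R -> k x = n.
  move=> /andP[nx xn]; have /andP[kx xk] := kP _ (le_lt_trans (ler0n _ _) nx).
  have := lt_le_trans nx xk; have := lt_le_trans kx xn.
  by rewrite !ltr_nat !ltnS => h1 h2; apply/eqP; rewrite eqn_leq h1.
pose sn n t : R := (k (t * n.+1%:R))%:R / n.+1%:R.
have n0 n : 0 < n.+1%:R :> R by rewrite ltr0Sn.
have snP n t : 0 < t -> [/\ 0 <= sn n t, sn n t < t & t <= sn n t + n.+1%:R^-1].
  move=> t0; have /andP[] := kP _ (mulr_gt0 t0 (n0 n)).
  rewrite /sn divr_ge0// ltr_pdivrMr// => -> h; split => //.
  by rewrite -{2}[_^-1]mul1r -mulrDl natr1 ler_pdivlMr.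
apply: (@measurable_fun_cvg _ _ _ _ (fun n z => Y (sn n (tau z)) z)).
  move=> n _ B mB.
  rewrite (_ : _ `&` _ = \bigcup_j (D `&` [set z | j%:R / n.+1%:R < tau z <=
      j.+1%:R / n.+1%:R] `&` Y (j%:R / n.+1%:R) @^-1` B)); last first.
    apply/seteqP; split => [z [Dz Bz]|z [j _ [[Dz]]]].
      exists (k (tau z * n.+1%:R)) => //; split => //; split => //=.
      by rewrite ltr_pdivrMr// ler_pdivlMr//; apply/kP/mulr_gt0/n0/tau0.
    rewrite /= ltr_pdivrMr// ler_pdivlMr// => /kU E Bz; split => //.
    by rewrite /preimage/= /sn E.
  apply: bigcup_measurable => j _; apply: mY => //.
  by rewrite ltr_pM2r ?invr_gt0// ltr_nat.
move=> z Dz; apply: cY => //.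
  by move=> n; have [-> ->] := snP n _ (tau0 _ Dz).
apply/cvgrPdist_le => e e0; near=> n.
have [s0 st ts] := snP n _ (tau0 _ Dz).
rewrite ger0_norm ?subr_ge0 ?(ltW st)//.
rewrite lerBlDl; apply: (le_trans ts); rewrite lerD2l ltW//.
by near: n; exact: near_infty_natSinv_lt (PosNum e0).
Unshelve. all: by end_near. Qed.

(** * Lipschitz bounds, extension in time and expansions of the coefficients *)

Lemma lipschitz_of_derive1 {R : realType} (h : R -> R) (K : R) :
  (forall x, derivable h x 1) -> (forall x, `|derive1 h x| <= K) ->
  forall x y, `|h x - h y| <= K * `|x - y|.
Proof.
move=> dh hK.
have hlt x y : x < y -> `|h y - h x| <= K * `|y - x|.
  move=> xy; have [||c _ ->] := @MVT _ h (derive1 h) x y xy.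
  - by move=> c _; rewrite derive1E; exact/derivableP.
  - apply: derivable_within_continuous => c _; exact: dh.
  - by rewrite normrM ler_wpM2r.
move=> x y; have [xy|yx|->] := ltgtP x y.
- by rewrite distrC [`|x - y|]distrC; exact: hlt.
- exact: hlt.
- by rewrite !subrr normr0 mulr0.
Qed.

(** The results on differential equations ask for a field on the whole time line. This extension
    keeps the Lipschitz constant and does not alter the equation on [[0, T]]. *)
Definition zero_extension {R : realType} (T : R) (f : R -> R -> R) t x : R :=
  if 0 <= t <= T then f t x else 0.

Lemma measurable_zero_extension {R : realType} (T : R) (f : R -> R -> R) :
  measurable_fun (`[0, T]%classic `*` [set: R]) (fun z : R * R => f z.1 z.2) ->
  measurable_fun setT (fun z : R * R => zero_extension T f z.1 z.2).
Proof.
move=> mf.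
have mD : measurable (`[0, T]%classic `*` [set: R] : set (R * R)).
  exact: measurableX.
have := (measurable_restrictT _ mD).1 mf.
apply: eq_measurable_fun => -[t x] _; rewrite /zero_extension patchE/=.
case: ifPn => [/set_mem[]|]; first by rewrite /= in_itv/= => ->.
by case: ifPn => // tT /negP[]; apply/mem_set; split => //=; rewrite in_itv.
Qed.

Lemma measurable_fun_curry2 {d} {U : measurableType d} {R : realType}
    (D : set U) (G : R -> R -> R) (a b : U -> R) :
  measurable D -> measurable_fun setT (fun z : R * R => G z.1 z.2) ->
  measurable_fun D a -> measurable_fun D b ->
  measurable_fun D (fun u => G (a u) (b u)).
Proof.
move=> mD mG ma mb.
have ma' := (measurable_restrictT _ mD).1 ma.
have mb' := (measurable_restrictT _ mD).1 mb.
have mp := measurable_funTS (measurableT_comp mG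
  (measurable_fun_pair ma' mb')) (D := D).
by apply: eq_measurable_fun mp => s sD; rewrite /= !patchE sD.
Qed.

Lemma derive_in_expansion {R : realType} (D : set R) (h : R -> R) (t e : R) :
  derivable_in D h t -> 0 < e -> exists2 d, 0 < d & forall s, D s ->
  `|s - t| < d -> `|h s - h t - derive_in D h t * (s - t)| <= e * `|s - t|.
Proof.
move=> dh e0; have : diff_quotient h t s @[s --> within D t^'] -->
  derive_in D h t by exact: dh.
move=> /cvgr_dist_le/(_ _ e0); rewrite !near_withinE => /nbhs_ballP[d /= d0 dP].
exists d => // s Ds sd; have [->|st] := eqVneq s t.
  by rewrite !subrr mulr0 subrr normr0 mulr0.
have := dP s; rewrite /ball/= distrC => /(_ sd st Ds).
have st0 : `|s - t| > 0 by rewrite normr_gt0 subr_eq0.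
rewrite -(ler_pM2r st0) -normrM; congr (_ <= _); rewrite -normrN; congr `|_|.
by rewrite /diff_quotient; field; rewrite subr_eq0.
Qed.

Lemma derivable_expansion {R : realType} (h : R -> R) (x e : R) :
  derivable h x 1 -> 0 < e -> exists2 d, 0 < d & forall y, `|y - x| < d ->
  `|h y - h x - derive1 h x * (y - x)| <= e * `|y - x|.
Proof.
move=> dh e0.
have : (fun k : R => k^-1 *: ((h \o shift x) (k *: 1) - h x)) @ 0^' --> 'D_1 h x.
  exact: dh.
rewrite derive1E => /cvgr_dist_le/(_ _ e0); rewrite near_withinE.
move=> /nbhs_ballP[d /= d0 dP].
exists d => // y yd; have [->|yx] := eqVneq y x.
  by rewrite !subrr mulr0 subrr normr0 mulr0.
have := dP (y - x); rewrite /ball/= sub0r normrN subr_eq0 => /(_ yd yx).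
rewrite /GRing.scale/= mulr1 subrK.
have yx0 : `|y - x| > 0 by rewrite normr_gt0 subr_eq0.
rewrite -(ler_pM2r yx0) -normrM; congr (_ <= _); rewrite -normrN; congr `|_|.
by field; rewrite subr_eq0.
Qed.

(** * The equation along a fixed counting path *)

Section sde_path.
Context {R : realType}.
Local Notation mu := (@lebesgue_measure R).
Variables (T K x0 : R) (f g : R -> R -> R).
Hypothesis T0 : 0 < T.
Hypothesis K0 : 0 < K.
Hypothesis f_lip : forall t x y, 0 <= t <= T -> `|f t x - f t y| <= K * `|x - y|.
Hypothesis g_lip : forall t x y, 0 <= t <= T -> `|g t x - g t y| <= K * `|x - y|.
Hypothesis mf : measurable_fun (`[0, T]%classic `*` [set: R])
  (fun z : R * R => f z.1 z.2).
Hypothesis mg : measurable_fun (`[0, T]%classic `*` [set: R])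
  (fun z : R * R => g z.1 z.2).
Hypothesis g_derivable : forall t, 0 <= t <= T ->
  derivable_in `[0, T]%classic (g^~ 0) t.
Variables (w : canonical_space R) (Z : R -> R).
Hypothesis Zr : forall t, t \in `[0, T[ -> Z s @[s --> t^'+] --> Z t.
Hypothesis Zl : forall t, t \in `]0, T] -> cvg (Z s @[s --> t^'-]).
Hypothesis Zeq : forall t, t \in `[0, T] ->
  mu.-integrable `[0, t] (fun s => (f s (Z s))%:E) /\
  Z t = x0 + \int[mu]_(s in `[0, t]) f s (Z s)
           + \int[dN w]_(s in `]0, t]) g s (left_lim Z s).

Let F := zero_extension T f.
Let h s := g s (left_lim Z s).

Lemma left_lim_path t : 0 < t <= T -> Z s @[s --> t^'-] --> left_lim Z t.
Proof. by move=> tT; apply: Zl; rewrite in_itv. Qed.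

Lemma path_bounded : exists2 M, 0 <= M & forall s, 0 <= s <= T -> `|Z s| <= M.
Proof.
apply: locally_bounded_segment => t /andP[t0 tT].
have [d1 [M1 [d10 dM1]]] : exists d M, 0 < d /\
    (forall s, t < s -> s <= T -> `|s - t| < d -> `|Z s| <= M).
  move: tT; rewrite le_eqVlt => /predU1P[->|tT].
    by exists 1, 0; split => // s Ts /(lt_le_trans Ts); rewrite ltxx.
  have := Zr (_ : t \in `[0, T[); rewrite in_itv/= t0 => /(_ tT).
  move=> /cvgr_dist_le/(_ 1 ltr01); rewrite near_withinE => /nbhs_ballP[d /= d0 dP].
  exists d, (`|Z t| + 1); split => // s ts _ sd.
  have := dP s; rewrite /ball/= distrC => /(_ sd ts).
  have := ler_normD (Z t) (- (Z t - Z s)); rewrite subKr normrN; lra.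
have [d2 [M2 [d20 dM2]]] : exists d M, 0 < d /\
    (forall s, s < t -> 0 <= s -> `|s - t| < d -> `|Z s| <= M).
  move: t0; rewrite le_eqVlt => /predU1P[<-|t0].
    by exists 1, 0; split => // s s0 /le_lt_trans/(_ s0); rewrite ltxx.
  have := left_lim_path (_ : 0 < t <= T); rewrite t0 => /(_ tT).
  move=> /cvgr_dist_le/(_ 1 ltr01); rewrite near_withinE => /nbhs_ballP[d /= d0 dP].
  exists d, (`|left_lim Z t| + 1); split => // s ts _ sd.
  have := dP s; rewrite /ball/= distrC => /(_ sd ts).
  have := ler_normD (left_lim Z t) (- (left_lim Z t - Z s)).
  rewrite subKr normrN; lra.
exists (Num.min d1 d2), (Num.max `|Z t| (Num.max M1 M2)); split.
  by rewrite lt_min d10.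
move=> s /andP[s0 sT]; rewrite lt_min => /andP[sd1 sd2].
rewrite !le_max; have [st|ts|->] := ltgtP s t; last by rewrite lexx.
- by rewrite dM2// !orbT.
- by rewrite dM1// orbT.
Qed.

Lemma left_lim_bounded M : (forall s, 0 <= s <= T -> `|Z s| <= M) ->
  forall t, 0 < t <= T -> `|left_lim Z t| <= M.
Proof.
move=> ZM t /[dup] tT0 /andP[t0 tT].
apply: (cvgr_to_le (cvg_norm (left_lim_path tT0))).
near=> s; apply: ZM; apply/andP; split.
  by near: s; exact: nbhs_left_ge.
apply: le_trans tT; near: s; exact: nbhs_left_le.
Unshelve. all: by end_near. Qed.

Lemma measurable_left_lim_path : measurable_fun `]0, T] (left_lim Z).
Proof.
apply: (@measurable_left_limit _ _ R `]0, T]%classic id (fun a _ => Z a)) => //.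
- by move=> z; rewrite /= in_itv/= => /andP[].
- move=> a b B a0 ab mB; apply: measurableI; first apply: measurableI => //.
    rewrite (_ : [set z | _] = `]a, b]%classic)//.
  have [Ba|Ba] := pselect (B (Z a)).
    by rewrite (_ : _ @^-1` _ = setT)//; apply/seteqP; split.
  by rewrite (_ : _ @^-1` _ = set0)//; apply/seteqP; split.
- move=> z; rewrite /= in_itv/= => zT s sz cs.
  have /cvg_at_leftP := left_lim_path zT; apply; split => //.
  by move=> n; have /andP[] := sz n.
Qed.

Lemma lipschitz_zero_extension t x y : `|F t x - F t y| <= K * `|x - y|.
Proof.
rewrite /F /zero_extension; case: ifPn => [tT|_]; first exact: f_lip.
by rewrite subrr normr0 mulr_ge0// ltW.
Qed.

(** The equation provides integrability of [f s (Z s)]. The path is bounded by its one-sided limits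
    and compactness, so by the Lipschitz condition [f s x] differs from [f s (Z s)] by a bounded
    amount. *)
Lemma integrable_zero_extension x : mu.-integrable setT (EFin \o F^~ x).
Proof.
have [M M0 ZM] := path_bounded.
have TT : T \in `[0, T] by rewrite in_itv/= lexx ltW.
have [iZ _] := Zeq TT.
have mF := measurable_zero_extension mf.
have mFx : measurable_fun setT (F^~ x).
  by apply: (measurable_fun_curry2 measurableT mF) => //; exact: measurable_cst.
have iFT : mu.-integrable `[0, T] (EFin \o F^~ x).
  have iM : mu.-integrable `[0, T] (EFin \o (fun s => `|f s (Z s)| + K * (M + `|x|))).
    apply: integrable_itvD; last exact: integrable_itv_cst.
    exact: integrable_itv_norm.
  apply: le_integrable iM => //.
    by apply/measurable_EFinP; exact: measurable_funTS.
  move=> s; rewrite /= in_itv/= => sT; rewrite lee_fin /F /zero_extension sT.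
  have h1 := f_lip x (Z s) sT.
  have h2 : `|x - Z s| <= M + `|x|.
    by have := ler_normB x (Z s); have := ZM _ sT; lra.
  have := ler_normD (f s x - f s (Z s)) (f s (Z s)); rewrite subrK.
  have := ler_norm (`|f s (Z s)| + K * (M + `|x|)).
  have := ler_wpM2l (ltW K0) h2; lra.
have mI : measurable (`[0, T]%classic : set (measurableTypeR R)).
  exact: measurable_itv.
have {}iFT := (integrable_mkcond _ mI).1 iFT.
apply: eq_integrable iFT => // s _; rewrite patchE.
case: ifPn => // /negP sT; rewrite /F /= /zero_extension.
by case: ifPn => // sT'; exfalso; apply: sT; rewrite inE/= in_itv.
Qed.

Lemma integrable_drift : mu.-integrable `[0, T] (EFin \o (fun s => F s (Z s))).
Proof.
have TT : T \in `[0, T] by rewrite in_itv/= lexx ltW.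
apply: eq_integrable (Zeq TT).1 => // s.
by rewrite inE/= in_itv/= /F /zero_extension => ->.
Qed.

(** The integrand is bounded and []0, T]] has finite mass: [g s 0] is bounded because it is
    differentiable in time at every point of [[0, T]], hence locally bounded, and the Lipschitz
    condition with the bounded path does the rest. *)
Lemma integrable_jumps : (dN w).-integrable `]0, T] (EFin \o h).
Proof.
have [M M0 ZM] := path_bounded.
have [N _ gN] : exists2 N, 0 <= N & forall s, 0 <= s <= T -> `|g s 0| <= N.
  apply: locally_bounded_segment => t tT.
  have [d d0 dP] := derive_in_expansion (g_derivable tT) ltr01.
  set l := derive_in _ _ _ in dP.
  exists d, (`|g t 0| + `|l| * d + d); split => // s sT sd.
  have := dP s; rewrite /= in_itv/= mul1r => /(_ sT sd) h1.
  have := ler_normD (g s 0 - g t 0 - l * (s - t)) (g t 0 + l * (s - t)).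
  have := ler_normD (g t 0) (l * (s - t)); rewrite normrM.
  have -> : g s 0 - g t 0 - l * (s - t) + (g t 0 + l * (s - t)) = g s 0 by ring.
  have := ler_wpM2l (normr_ge0 l) (ltW sd); lra.
apply: (@integrable_dN _ w 0 T h (N + K * M)).
  have ml := measurable_left_lim_path.
  have := measurable_fun_curry2 (measurable_itv `]0, T])
    (measurable_zero_extension mg) (@measurable_id _ _ _) ml.
  apply: eq_measurable_fun => s; rewrite inE/= in_itv/= => /andP[s0 sT].
  by rewrite /zero_extension (ltW s0) sT.
move=> s /andP[s0 sT]; have sT' : 0 <= s <= T by rewrite ltW.
have h1 := g_lip (left_lim Z s) 0 sT'; rewrite subr0 in h1.
have h2 := left_lim_bounded ZM (_ : 0 < s <= T); rewrite s0 sT in h2.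
have := ler_wpM2l (ltW K0) (h2 isT); have := gN _ sT'.
have := ler_normD (g s (left_lim Z s) - g s 0) (g s 0); rewrite subrK /h; lra.
Qed.

Lemma path_increment s t : 0 <= s -> s <= t -> t <= T ->
  Z t - Z s = \int[mu]_(v in `[s, t]) F v (Z v) + \int[dN w]_(v in `]s, t]) h v.
Proof.
move=> s0 st tT.
have fF r : 0 <= r -> r <= T ->
    \int[mu]_(v in `[0, r]) f v (Z v) = \int[mu]_(v in `[0, r]) F v (Z v).
  move=> r0 rT; apply: eq_Rintegral => v; rewrite inE/= in_itv/= => /andP[v0 vr].
  by rewrite /F /zero_extension v0 (le_trans vr).
have ZE r : 0 <= r -> r <= T -> Z r = x0 + \int[mu]_(v in `[0, r]) F v (Z v)
    + \int[dN w]_(v in `]0, r]) h v.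
  by move=> r0 rT; rewrite -fF//; apply: (Zeq _).2; rewrite in_itv/= r0.
rewrite (ZE t) ?(le_trans s0)// (ZE s) ?(le_trans st)//.
rewrite (@Rintegral_itv_chasles _ _ 0 t s)//; last first.
  exact: integrable_subitv integrable_drift.
have -> : \int[dN w]_(v in `]0, t]) h v =
    \int[dN w]_(v in `]0, s]) h v + \int[dN w]_(v in `]s, t]) h v.
  apply: Rintegral_dN_chasles => //.
  apply: integrableS integrable_jumps => //.
  by apply: subset_itvl; rewrite bnd_simp.
move: (\int[dN w]_(v in `]0, s]) h v) (\int[dN w]_(v in `]s, t]) h v) => a b.
ring.
Qed.

Lemma path_ode_solution s t : 0 <= s -> s <= t -> t <= T -> w s = w t ->
  ode_solution F Z s t.
Proof.
move=> s0 st tT wst; split; first exact: integrable_subitv integrable_drift.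
move=> r /andP[sr rt]; apply/eqP; rewrite -subr_eq0 opprD addrA.
rewrite path_increment ?(le_trans rt)// Rintegral_dN_null ?addr0 ?subrr//.
have wsr : w s = w r.
  by apply/eqP; rewrite eq_le path_mono//= wst path_mono.
by apply: etrans (dN_itv w sr) _; rewrite wsr subrr.
Qed.

(** As [s] increases to [t] in [path_increment], the drift integral vanishes and only the constant
    jump integral survives. It is used with [J = 0] away from jumps and with
    [J = g t (left_lim Z t)] at an isolated jump. *)
Lemma left_lim_path_eq r t (J : R) : 0 <= r -> r < t -> t <= T ->
  (forall s, r <= s -> s < t -> \int[dN w]_(v in `]s, t]) h v = J) ->
  Z t = left_lim Z t + J.
Proof.
move=> r0 rt tT intJ.
have t0 : 0 < t <= T by rewrite (le_lt_trans r0 rt).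
have iF := integrable_subitv r0 tT integrable_drift.
pose I s := parameterized_integral mu r s (fun v => F v (Z v)).
have cI : Z t - J - (I t - I s) @[s --> t^'-] --> Z t - J - (I t - I t).
  apply: cvgB; first exact: cvg_cst.
  apply: cvgB; first exact: cvg_cst.
  exact: parameterized_integral_cvg_at_left iF.
have E : left_lim Z t = Z t - J - (I t - I t).
  apply: (cvg_lim (@Rhausdorff R)).
  apply: cvg_trans cI; apply: near_eq_cvg; near=> s.
  have rs : r <= s by near: s; exact: nbhs_left_ge.
  have st : s < t by near: s; exact: nbhs_left_lt.
  have := path_increment (le_trans r0 rs) (ltW st) tT; rewrite intJ//.
  rewrite /I /parameterized_integral.
  rewrite (Rintegral_itv_chasles rs (ltW st) iF); lra.
by rewrite E; ring.
Unshelve. all: by end_near. Qed.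

Lemma left_lim_path_const r t : 0 <= r -> r < t -> t <= T -> w r = w t ->
  left_lim Z t = Z t.
Proof.
move=> r0 rt tT wrt; rewrite [RHS](@left_lim_path_eq r t 0) ?addr0//.
move=> s rs st; apply: Rintegral_dN_null => //.
apply: etrans (dN_itv w (ltW st)) _.
suff -> : w s = w t by rewrite subrr.
apply/eqP; rewrite eq_le (path_mono w (ltW st))/= -wrt; exact: path_mono.
Qed.

Lemma path_jump r t : 0 <= r -> r < t -> t <= T ->
  dN w `]r, t[%classic = 0%E -> dN w [set t] = 1%E ->
  Z t = left_lim Z t + g t (left_lim Z t).
Proof.
move=> r0 rt tT d0 d1; apply: (@left_lim_path_eq r) => // s rs st.
apply: Rintegral_dN_atom => //.
- apply/eqP; rewrite eq_le measure_ge0 andbT -d0 le_measure ?inE//.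
  by apply: subset_itvr; rewrite bnd_simp.
- apply: integrableS integrable_jumps => //.
  by apply: subset_itv; rewrite bnd_simp// (le_trans r0).
Qed.

End sde_path.

Lemma coefficient_lipschitz {R : realType} (T : R) (f g : R -> R -> R) :
  coefficient_assumptions T f g -> exists2 K, 0 < K &
  forall t, 0 <= t <= T -> forall x y, `|f t x - f t y| <= K * `|x - y| /\
    `|g t x - g t y| <= K * `|x - y|.
Proof.
move=> fg; have [K fgK] := fg_bounded_gradient fg.
have K1 : K <= Num.max 1 K by rewrite le_max lexx orbT.
exists (Num.max 1 K); first by rewrite lt_max ltr01.
move=> t tT; have tT' : t \in `[0, T] by rewrite in_itv.
have fK x : `|derive1 (f t) x| <= Num.max 1 K.
  have := fgK t x tT'; have := normr_ge0 (derive1 (g t) x); lra.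
have gK x : `|derive1 (g t) x| <= Num.max 1 K.
  have := fgK t x tT'; have := normr_ge0 (derive1 (f t) x); lra.
move=> x y; split.
- by apply: lipschitz_of_derive1 => // z; exact: (f_C1 fg tT').1.
- by apply: lipschitz_of_derive1 => // z; exact: (g_C1 fg tT').1.
Qed.

(** * Jump times of a fixed path that lead into a null set *)

Section pathwise.
Context {R : realType}.
Local Notation mu := (@lebesgue_measure R).
Variables (T K x0 : R) (f g : R -> R -> R).
Hypothesis T0 : 0 < T.
Hypothesis K0 : 0 < K.
Hypothesis fg : coefficient_assumptions T f g.
Hypothesis fg_lip : forall t, 0 <= t <= T ->
  forall x y, `|f t x - f t y| <= K * `|x - y| /\
    `|g t x - g t y| <= K * `|x - y|.
Variables (w : canonical_space R) (Z : R -> R).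
Hypothesis Zr : forall t, t \in `[0, T[ -> Z s @[s --> t^'+] --> Z t.
Hypothesis Zl : forall t, t \in `]0, T] -> cvg (Z s @[s --> t^'-]).
Hypothesis Zeq : forall t, t \in `[0, T] ->
  mu.-integrable `[0, t] (fun s => (f s (Z s))%:E) /\
  Z t = x0 + \int[mu]_(s in `[0, t]) f s (Z s)
           + \int[dN w]_(s in `]0, t]) g s (left_lim Z s).

Let F := zero_extension T f.
Let f_lip t x y (tT : 0 <= t <= T) := (fg_lip tT x y).1.
Let g_lip t x y (tT : 0 <= t <= T) := (fg_lip tT x y).2.
Let mF := measurable_zero_extension (f_measurable fg).
Let lipF := lipschitz_zero_extension K0 f_lip.
Let intF := integrable_zero_extension T0 K0 f_lip (f_measurable fg) Zr Zl Zeq.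
Let g_derivable t (tT : 0 <= t <= T) : derivable_in `[0, T]%classic (g^~ 0) t.
Proof. by apply: (g_derivable_time fg); rewrite in_itv. Qed.

Lemma flow_after_last_jump : 1 <= w T -> exists t, [/\ 0 < t <= T,
  dN w [set t] = 1%E & Z T = flow F T t (left_lim Z t + g t (left_lim Z t))].
Proof.
move=> wT1; have [r [t [r0 rt tT wt [d0 d1 _]]]] := last_jump T0 wT1.
exists t; split => //; first by rewrite (le_lt_trans r0).
have t0 := le_trans r0 (ltW rt).
rewrite -(path_jump T0 K0 g_lip (g_measurable fg) g_derivable Zr Zl Zeq r0 rt tT)//.
rewrite (flowE K0 lipF tT)//.
exact: (path_ode_solution T0 K0 g_lip (g_measurable fg) g_derivable Zr Zl Zeq).
Qed.

Hypothesis phi_neq0 : forall t x, t \in `[0, T] -> phi T f g t x != 0.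

(** Between two times at which [w] equals [n] there is no jump, so the path solves the differential
    equation there, and left limits are values except possibly at the first such time. Discarding
    one time for each [n] reduces the claim to [exceptional_times_negligible] with [z] the path
    itself. *)
Lemma critical_jump_times_negligible (B : set R) : mu.-negligible B ->
  mu.-negligible [set t | 0 < t <= T /\
    B (flow F T t (left_lim Z t + g t (left_lim Z t)))].
Proof.
move=> nB.
pose J (n : nat) := [set t | 0 < t <= T /\ w t = n%:R].
(* [J n `\` L n] contains at most the left endpoint of the interval [w = n]. *)
pose L n := J n `&` [set t | exists r, [/\ 0 <= r, r < t & w r = w t]].
apply: (@negligibleS _ _ _ mu ((\bigcup_n (J n `\` L n)) `|`
  \bigcup_n (L n `&` [set t | B (flow F T t (Z t + g t (Z t)))]))).
  move=> t [tT Bt]; have /natrP[n wn] := path_nat w t.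
  have [Lt|Lt] := pselect (L n t); last by left; exists n.
  right; exists n => //; split => //=.
  have [_ [r [r0 rt wrt]]] := Lt.
  rewrite -(left_lim_path_const T0 K0 g_lip (g_measurable fg) g_derivable Zr Zl
    Zeq r0 rt _ wrt)//.
  by move/andP: tT => [].
apply: negligibleU; apply: negligible_bigcup => n.
  have [[t0 Jt0]|noJ] := pselect (exists t, (J n `\` L n) t); last first.
    apply: (@negligibleS _ _ _ mu set0); last exact: negligible_set0.
    by move=> t Jt; apply: noJ; exists t.
  apply: (@negligibleS _ _ _ mu [set t0]); last first.
    by apply/negligibleP => //; exact: lebesgue_measure_set1.
  have below s t : (J n `\` L n) s -> (J n `\` L n) t -> s < t -> False.
    move=> [[/andP[s0 _] ws] _] [[tT wt] Lt] st; apply: Lt; split => //.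
    by exists s; rewrite ws wt (ltW s0).
  move=> t Jt; have [tt0|tt0|->//] := ltgtP t t0; exfalso.
  - exact: below Jt Jt0 tt0.
  - exact: below Jt0 Jt tt0.
apply: (@exceptional_times_negligible _ F K T K0 mF lipF intF g
  (fun t => derive1 (g t)) (fun t x => derive_in `[0, T]%classic (g^~ x) t)) => //.
- move=> t x e tT e0; apply: derivable_expansion => //.
  by apply: (g_C1 fg _).1; rewrite in_itv.
- move=> t x e tT e0.
  have tT' : t \in `[0, T] by rewrite in_itv.
  have [d d0 dP] := derive_in_expansion (g_derivable_time fg (x := x) tT') e0.
  by exists d => // s sT; apply: dP; rewrite /= in_itv.
- move=> t x tT; have := phi_neq0 x (_ : t \in `[0, T]).
  by rewrite /phi /F /zero_extension tT in_itv; apply.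
- by move=> s [[/andP[/ltW -> ->]]].
- move=> s t [[/andP[s0 _] ws] _] [[/andP[_ tT] wt] _] st.
  apply: (path_ode_solution T0 K0 g_lip (g_measurable fg) g_derivable Zr Zl Zeq).
  - exact: ltW.
  - exact: ltW.
  - exact: tT.
  - by rewrite ws wt.
Qed.

End pathwise.

(** * Predictability *)

Section predictable_processes.
Context {R : realType}.
Local Notation predictable_space := (g_sigma_algebraType (@predictable_rectangles R)).
Variable T : R.

Let horizon : set predictable_space := [set u | 0 < u.1 <= T].

Lemma natural_filtration_sigma_algebra (t : R) :
  sigma_algebra setT (@natural_filtration R t).
Proof. exact: smallest_sigma_algebra. Qed.

Lemma natural_filtrationT (t : R) : @natural_filtration R t setT.
Proof.
have [N0 NC _] := natural_filtration_sigma_algebra t.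
by rewrite -(setD0 setT); exact: NC.
Qed.

Lemma measurable_predictable_rectangle (a b : R) (A : set (canonical_space R)) :
  0 <= a -> natural_filtration a A ->
  measurable ([set u | a < u.1 <= b /\ A u.2] : set predictable_space).
Proof.
move=> a0 mA; have [ab|ba] := leP a b; last first.
  rewrite (_ : [set u | _] = set0)//; apply/seteqP; split => // u [/andP[au ub]].
  by have := lt_le_trans au ub; rewrite ltNge (ltW ba).
by apply: sub_sigma_algebra; exists a, b, A.
Qed.

Lemma measurable_horizon : measurable horizon.
Proof.
rewrite (_ : horizon = [set u | 0 < u.1 <= T /\ setT u.2]).
  by apply: measurable_predictable_rectangle => //; exact: natural_filtrationT.
by apply/seteqP; split => // u [].
Qed.

(** The value read on [a < u.1 <= b] is [Y a], measurable for the past at [a], so the sets to check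
    are generating rectangles cut at [T]. *)
Lemma predictable_left_limit (Y : R -> canonical_space R -> R)
    (l : predictable_space -> R) :
  (forall a B, 0 <= a <= T -> measurable B -> natural_filtration a (Y a @^-1` B)) ->
  (forall u, horizon u -> forall s : nat -> R, (forall n, 0 <= s n < u.1) ->
    s @ \oo --> u.1 -> Y (s n) u.2 @[n --> \oo] --> l u) ->
  measurable_fun horizon l.
Proof.
move=> mY cY; apply: (@measurable_left_limit _ _ _ horizon fst
  (fun a u => Y a u.2)) => //; first exact: measurable_horizon.
  by move=> u /andP[].
move=> a b B a0 ab mB.
have [aT|Ta] := leP a T; last first.
  rewrite (_ : _ `&` _ = set0)//; apply/seteqP; split => // u [[/andP[_ uT]]] /=.
  by move=> /andP[/lt_le_trans/(_ uT)]; rewrite ltNge (ltW Ta).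
rewrite (_ : _ `&` _ = [set u | a < u.1 <= Num.min b T /\ (Y a @^-1` B) u.2]).
  by apply: measurable_predictable_rectangle => //; apply: mY => //; rewrite a0.
apply/seteqP; split => u.
- by move=> [[/andP[u0 uT]/= /andP[au ub]] Bu]; rewrite le_min au ub uT.
- move=> [/=]; rewrite le_min => /and3P[au ub uT] Bu; split => //; split.
    by apply/andP; split => //; exact: le_lt_trans au.
  by rewrite /= au.
Qed.

End predictable_processes.

(** * Predictability of the resampled terminal state *)

Section post_jump_state.
Context {R : realType}.
Local Notation mu := (@lebesgue_measure R).
Variables (T K : R) (f g : R -> R -> R).
Hypothesis K0 : 0 < K.
Let F := zero_extension T f.
Hypothesis mF : measurable_fun setT (fun z : R * R => F z.1 z.2).
Hypothesis lipF : forall t x y, `|F t x - F t y| <= K * `|x - y|.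
Hypothesis intF : forall x, mu.-integrable setT (EFin \o F^~ x).
Hypothesis mg : measurable_fun (`[0, T]%classic `*` [set: R])
  (fun z : R * R => g z.1 z.2).

Let strip : set (R * R) := [set z | 0 < z.1 <= T].

Let measurable_strip : measurable strip.
Proof.
rewrite (_ : strip = `]0, T]%classic `*` setT); first exact: measurableX.
by apply/seteqP; split => -[t x]; rewrite /strip /= in_itv//= => -[].
Qed.

(** Continuity in the state at each starting time and left continuity in the starting time give
    joint measurability. *)
Lemma measurable_flow :
  measurable_fun setT (fun z : R * R => if 0 < z.1 <= T then flow F T z.1 z.2 else 0).
Proof.
have mflow : measurable_fun strip (fun z => flow F T z.1 z.2).
  (* Measurability of [Y a] is asked for every [a >= 0], including [a > T] where the slab is empty
     and the flow arbitrary; hence [Num.min a T]. *)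
  apply: (@measurable_left_limit _ _ R strip fst
    (fun a z => flow F T (Num.min a T) z.2)) => //.
  - by move=> z /andP[].
  - move=> a b B a0 ab mB; apply: measurableI.
      apply: measurableI => //.
      rewrite (_ : [set z | _] = `]a, b]%classic `*` setT); first exact: measurableX.
      by apply/seteqP; split => -[t x]; rewrite /= in_itv//= => -[].
    have aT : Num.min a T <= T by rewrite ge_min lexx orbT.
    have mf := continuous_measurable_fun (continuous_flow K0 mF lipF intF aT).
    have := measurableT_comp mf (@measurable_snd _ _ R R).
    by move=> /(_ measurableT B mB); rewrite setTI.
  - move=> z /andP[_ zT] s sz cs.
    have snz n : s n <= z.1 by have /andP[_ /ltW] := sz n.
    have := flow_left_cvg K0 mF lipF intF (x := z.2) zT snz cs.
    apply: cvg_trans; apply: near_eq_cvg; apply: nearW => n /=.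
    by rewrite min_l// (le_trans (snz n)).
have := (measurable_restrictT _ measurable_strip).1 mflow.
apply: eq_measurable_fun => z _; rewrite patchE.
case: ifPn => [/set_mem ->//|]; case: ifPn => // zT /negP[].
exact/mem_set.
Qed.

Variable X : R -> canonical_space R -> R.
Hypothesis X_adapted : forall t, t \in `[0, T] ->
  forall B : set R, measurable B -> natural_filtration t (X t @^-1` B).
Hypothesis X_left_limits : forall w t, t \in `]0, T] -> cvg (X s w @[s --> t^'-]).

Lemma measurable_critical_jump_times (B : set R) : measurable B ->
  measurable ([set u | 0 < u.1 <= T /\
    B (flow F T u.1 (left_lim (X^~ u.2) u.1 + g u.1 (left_lim (X^~ u.2) u.1)))]
    : set (g_sigma_algebraType (@predictable_rectangles R))).
Proof.
move=> mB.
pose D : set (g_sigma_algebraType (@predictable_rectangles R)) :=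
  [set u | 0 < u.1 <= T].
have mD : measurable D by exact: measurable_horizon.
have mtime : measurable_fun D fst.
  apply: (@predictable_left_limit _ T (fun a _ => a)) => [a C aT mC|u _ s _ //].
  have [Ca|Ca] := pselect (C a).
    rewrite (_ : _ @^-1` _ = setT); first exact: natural_filtrationT.
    by apply/seteqP; split.
  rewrite (_ : _ @^-1` _ = set0); last by apply/seteqP; split.
  by have [] := natural_filtration_sigma_algebra a.
have mleft : measurable_fun D (fun u => left_lim (X^~ u.2) u.1).
  apply: (@predictable_left_limit _ T X) => [a C aT mC|u uT s sz cs].
    by apply: X_adapted => //; rewrite in_itv.
  have /cvg_at_leftP : X r u.2 @[r --> u.1^'-] --> left_lim (X^~ u.2) u.1.
    by apply: X_left_limits; rewrite in_itv.
  by apply; split => // n; have /andP[] := sz n.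
have mjump := measurable_fun_curry2 mD (measurable_zero_extension mg) mtime mleft.
have := measurable_fun_curry2 (G := fun t x => if 0 < t <= T then flow F T t x else 0)
  mD measurable_flow mtime (measurable_funD mleft mjump).
move=> /(_ mD B mB); congr measurable; apply/seteqP; split => u.
- move=> [/[dup] uT /andP[u0 u1]]; rewrite /= uT /zero_extension u1 (ltW u0).
  by split.
- move=> [/[dup] uT /andP[u0 u1]] Bu; split => //.
  by rewrite /= uT /zero_extension u1 (ltW u0).
Qed.

End post_jump_state.

Lemma measurable_natural_filtration {R : realType} (t : R) (A : set (canonical_space R)) :
  0 <= t -> natural_filtration t A -> measurable A.
Proof.
move=> t0; apply: smallest_sub; first exact: sigma_algebra_measurable.
move=> E [s]; rewrite /= in_itv/= => /andP[s0 _] sE.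
by apply: sub_sigma_algebra; exists s => //; rewrite /halfline/= in_itv/= s0.
Qed.

Lemma measurable_N {R : realType} (t : R) (B : set R) : 0 <= t -> measurable B ->
  measurable (@N_ R t @^-1` B).
Proof.
move=> t0 mB; apply: sub_sigma_algebra; exists t; rewrite /halfline/= ?in_itv/= ?t0//.
by exists B => //; rewrite setTI.
Qed.

Unset Implicit Arguments.

Theorem theorem5p9 (R : realType) (T : R) (T_gt0 : 0 < T)
    (lambda mu gamma : R -> R)
    (hawkes_hyp : hawkes_assumptions lambda mu gamma)
    (P : probability (canonical_space R) R)
    (hawkes_N : nonlinear_hawkes P lambda mu gamma)
    (f g : R -> R -> R) (fg_hyp : coefficient_assumptions T f g)
    (x0 : R) (X : R -> canonical_space R -> R)
    (X_sol : sde_solution P T f g x0 X)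
    (phi_neq0 : forall t x : R, t \in `[0, T] -> phi T f g t x != 0) :
  conditional_law P [set w | 1 <= N_ T w] (X T) `<< @lebesgue_measure R.
Proof.
move=> B nullB A mA AB; rewrite /conditional_law.
have nA : lebesgue_measure.-negligible A.
  by apply/negligibleP => //; exact: nullB.
set E := _ `&` _.
(* A null numerator makes the quotient 0 even when the conditioning event is itself null, as
   division by 0 returns 0. *)
suff -> : P E = 0%E by rewrite mul0r.
have mE : measurable E.
  apply: measurableI.
    rewrite (_ : [set w | _] = @N_ R T @^-1` `[1, +oo[); last first.
      by apply/seteqP; split => w; rewrite /= in_itv/= andbT.
    by apply: measurable_N => //; exact: ltW.
  apply: (@measurable_natural_filtration _ T); first exact: ltW.
  by apply: (sde_adapted X_sol) => //; rewrite in_itv/= lexx ltW.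
have [K K0 fg_lip] := coefficient_lipschitz fg_hyp.
have [M [mM M0 sde_M]] := sde_equation X_sol.
have sde w : ~ M w -> forall t, t \in `[0, T] ->
    lebesgue_measure.-integrable `[0, t] (fun s => (f s (X s w))%:E) /\
    X t w = x0 + \int[lebesgue_measure]_(s in `[0, t]) f s (X s w)
               + \int[dN w]_(s in `]0, t]) g s (left_lim (X^~ w) s).
  by move=> Mw; apply: contrapT => nsde; apply: Mw; exact: sde_M.
have rc w t : t \in `[0, T[ -> X s w @[s --> t^'+] --> X t w.
  by move=> tT; exact: (sde_right_continuous X_sol).
have ll w t : t \in `]0, T] -> cvg (X s w @[s --> t^'-]).
  by move=> tT; exact: (sde_left_limits X_sol).
have f_lip t x y (tT : 0 <= t <= T) := (fg_lip t tT x y).1.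
have mF := measurable_zero_extension (f_measurable fg_hyp).
have lipF := lipschitz_zero_extension K0 f_lip.
(* A single good path suffices: the integrability drawn from it concerns the deterministic field
   alone. *)
have [w0 Mw0] : exists w, ~ M w.
  apply: contrapT => noM; have MT : M = setT.
    by apply/seteqP; split => // w _; apply: contrapT => Mw; apply: noM; exists w.
  by have := @probability_setT _ _ _ P; rewrite -MT M0 => /esym/eqP; rewrite onee_eq0.
have intF := integrable_zero_extension T_gt0 K0 f_lip (f_measurable fg_hyp)
  (rc w0) (ll w0) (sde w0 Mw0).
pose G : set (R * canonical_space R) := [set u | 0 < u.1 <= T /\
  A (flow (zero_extension T f) T u.1
      (left_lim (X^~ u.2) u.1 + g u.1 (left_lim (X^~ u.2) u.1)))].
have mG : measurable (G : set (g_sigma_algebraType (@predictable_rectangles R))).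
  have ad : forall t, t \in `[0, T] ->
      forall C : set R, measurable C -> natural_filtration t (X t @^-1` C).
    by move=> t tT; exact: (sde_adapted X_sol).
  exact: (measurable_critical_jump_times K0 mF lipF intF (g_measurable fg_hyp)
    ad ll mA).
have predG : predictable (\1_G : R * canonical_space R -> R).
  have := @measurable_indic _ (g_sigma_algebraType (@predictable_rectangles R)) R setT G mG.
  exact.
have G0 z : 0 <= (\1_G : R * canonical_space R -> R) z by rewrite indicE ler0n.
(* Off [M], the critical times of a path are Lebesgue-null, so the inner integral on the right
   vanishes whatever values the intensity takes at them. *)
have := hawkes_N _ predG G0; rewrite [RHS](@integral_null_support _ _ R P _ M)//.
  move=> compensated.
  have EM0 : P (E `\` M) = 0%E.
    apply/eqP; rewrite eq_le measure_ge0 andbT -compensated.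
    apply: measure_le_integral => //; first exact: measurableD.
      by move=> w _; apply: integral_ge0 => s _; rewrite lee_fin; exact: G0.
    move=> w [[NT XA] Mw].
    have [t [tT dNt XT]] := flow_after_last_jump T_gt0 K0 fg_hyp fg_lip
      (rc w) (ll w) (sde w Mw) NT.
    (* The unit atom at the last jump alone makes the inner integral at least 1, so the outer one is
       at least the probability of the event. *)
    rewrite -dNt; apply: measure_le_integral => //.
    - by move=> s ->; rewrite /= in_itv/= andbT; case/andP: tT.
    - move=> s ->; rewrite lee_fin indicE mem_set//.
      by split => //=; rewrite -XT.
  apply/negligibleP => //; apply: (@negligibleS _ _ _ P (E `\` M `|` M)).
    by move=> w Ew; have [Mw|Mw] := pselect (M w); [right|left].
  apply: negligibleU; last by apply/negligibleP.
  by apply/negligibleP => //; exact: measurableD.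
move=> w _ Mw.
have [N [mN N0 GN]] := critical_jump_times_negligible T_gt0 K0 fg_hyp fg_lip
  (rc w) (ll w) (sde w Mw)
  phi_neq0 nA.
apply: (@integral_null_support _ _ R lebesgue_measure _ N) => // s _ Ns.
rewrite indicE memNset ?mul0r// => Gs; apply: Ns; exact: GN.
Qed.
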